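(* Let $\sigma\neq 0$ be a real constant. Assume that $\boldsymbol{u}=(u^1,u^2,u^3)$ and $\boldsymbol{h}=(h^1,h^2,h^3)$ are bounded smooth vector fields on $\mathbb{R}^3$ which, together with some smooth scalar function $P$ on $\mathbb{R}^3$, solve the steady MHD system \[ -\Delta \boldsymbol{u} + (\boldsymbol{u}\cdot\nabla)\boldsymbol{u} - (\boldsymbol{h}\cdot\nabla)\boldsymbol{h} + \nabla P = 0,\qquad -\Delta \boldsymbol{h} + (\boldsymbol{u}\cdot\nabla)\boldsymbol{h} - (\boldsymbol{h}\cdot\nabla)\boldsymbol{u} = 0,\qquad \nabla\cdot\boldsymbol{u} = \nabla\cdot\boldsymbol{h} = 0 \] in $\mathbb{R}^3$, and assume that $\boldsymbol{u}$ and $\boldsymbol{h}$ are helically symmetric with pitch $\sigma$. Then $\boldsymbol{u}$ and $\boldsymbol{h}$ are constant vectors of the form $\boldsymbol{u}=(0,0,C_1)$ and $\boldsymbol{h}=(0,0,C_2)$ for some constants $C_1,C_2\in\mathbb{R}$.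
   Context: For $\rho\in\mathbb{R}$ let $R_\rho$ be the matrix with rows $(\cos\rho,\ \sin\rho,\ 0)$, $(-\sin\rho,\ \cos\rho,\ 0)$, $(0,\ 0,\ 1)$, and define $S_\rho:\mathbb{R}^3\to\mathbb{R}^3$ by $S_\rho(\boldsymbol{x}) = R_\rho \boldsymbol{x} + (0,0,\sigma\rho)^T$. A vector field $\boldsymbol{v}$ on $\mathbb{R}^3$ is called helically symmetric with pitch $\sigma$ if $\boldsymbol{v}(S_\rho(\boldsymbol{x})) = R_\rho \boldsymbol{v}(\boldsymbol{x})$ for all $\rho\in\mathbb{R}$ and all $\boldsymbol{x}\in\mathbb{R}^3$. *)

(* Defs.v *)
From Stdlib Require Import Reals List.
From Coquelicot Require Import Coquelicot.
Open Scope R_scope.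

Definition R3 : Type := (R * R * R)%type.

Inductive dir : Type := D1 | D2 | D3.

Definition coord (d : dir) (p : R3) : R :=
  match p with (x, y, z) =>
    match d with D1 => x | D2 => y | D3 => z end end.

Definition upd (d : dir) (p : R3) (t : R) : R3 :=
  match p with (x, y, z) =>
    match d with D1 => (t, y, z) | D2 => (x, t, z) | D3 => (x, y, t) end end.

Definition pd (d : dir) (f : R3 -> R) : R3 -> R :=
  fun p => Derive (fun t => f (upd d p t)) (coord d p).

Fixpoint iter_pd (l : list dir) (f : R3 -> R) : R3 -> R :=
  match l with nil => f | d :: l' => pd d (iter_pd l' f) end.

Definition smooth (f : R3 -> R) : Prop :=
  forall l : list dir,
    (forall (d : dir) (p : R3),
        ex_derive (fun t => iter_pd l f (upd d p t)) (coord d p)) /\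
    (forall p : R3, continuous (iter_pd l f) p).

Definition comp (d : dir) (v : R3 -> R3) : R3 -> R := fun p => coord d (v p).

Definition smooth_vf (v : R3 -> R3) : Prop := forall d, smooth (comp d v).

Definition bounded_vf (v : R3 -> R3) : Prop :=
  exists M : R, forall (p : R3) (d : dir), Rabs (comp d v p) <= M.

Definition laplacian (f : R3 -> R) : R3 -> R :=
  fun p => pd D1 (pd D1 f) p + pd D2 (pd D2 f) p + pd D3 (pd D3 f) p.

Definition adv (a : R3 -> R3) (f : R3 -> R) : R3 -> R :=
  fun p => comp D1 a p * pd D1 f p + comp D2 a p * pd D2 f p
           + comp D3 a p * pd D3 f p.

Definition div (v : R3 -> R3) : R3 -> R :=
  fun p => pd D1 (comp D1 v) p + pd D2 (comp D2 v) p + pd D3 (comp D3 v) p.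

Definition steady_MHD (u h : R3 -> R3) (P : R3 -> R) : Prop :=
  (forall (i : dir) (p : R3),
     - laplacian (comp i u) p + adv u (comp i u) p - adv h (comp i h) p
       + pd i P p = 0) /\
  (forall (i : dir) (p : R3),
     - laplacian (comp i h) p + adv u (comp i h) p - adv h (comp i u) p = 0) /\
  (forall p : R3, div u p = 0) /\
  (forall p : R3, div h p = 0).

Definition Rrot (rho : R) (p : R3) : R3 :=
  match p with (x, y, z) =>
    (cos rho * x + sin rho * y, - sin rho * x + cos rho * y, z) end.

Definition Shel (sigma rho : R) (p : R3) : R3 :=
  match Rrot rho p with (x, y, z) => (x, y, z + sigma * rho) end.

Definition helically_symmetric (sigma : R) (v : R3 -> R3) : Prop :=
  forall (rho : R) (p : R3), v (Shel sigma rho p) = Rrot rho (v p).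

(* Main.v *)
(** Let [T] be a multiple of the period [2 pi |sigma|] and let [<f>(x)] be the
    integral of [f (x, 0, z)] over [0 <= z <= T].  A helical field is determined
    by its restriction to the half-plane [y = 0, x > 0], and helical symmetry
    expresses its [y]-derivatives there through [z]-derivatives.  The divergence
    theorem thus becomes [(x <F1>)' = x <div F>].

    Applied to [u] and [h] it shows that [u1] and [h1] have zero mean in [z], so
    that Poincare's inequality bounds them by [rms], the square root of
    [T <|grad u|^2 + |grad h|^2>].  Applied to the energy flux [F] it gives
    [E' = x rms^2 / T] for [E = x <F1>].  The pressure enters [F1] only through
    [u1 P].  Writing [x u1 = d_z psi] and integrating by parts in [z] replaces
    [P] by [P_z], which is the divergence of the axial momentum flux, so no
    regularity theory is needed to control [P].  The outcome is [E = A + B']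
    where [A] and [B] are at most [K x rms] for [x >= 1].  This is the borderline
    (two-dimensional) situation in which a logarithmic cutoff forces [E <= 0];
    since [E 0 = 0] and [E] is nondecreasing, the gradients vanish. *)

From Stdlib Require Import Reals ZArith List Lra Lia.
From Stdlib Require Import FunctionalExtensionality IndefiniteDescription.
From Coquelicot Require Import Coquelicot.
Require Import Defs.
Open Scope R_scope.

(** * Calculus of smooth scalar fields *)

(** [P] is assumed neither helical nor bounded, and the equations control only its gradient.
    Symmetry is therefore used infinitesimally, through the generator [Lie] of the screw motions,
    and periodicity and invariance of [P] have to be proved before the energy flux can enter the
    divergence theorem.

    Replacing [P_z] by a divergence creates an integral of [psi] against the [x]-derivative of the
    axial flux. It contains second derivatives of [u], which [rms] does not control. Pulling this
    derivative out of the integral gives the exact derivative [B']. Every term that remains has a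
    first derivative or one of the radial components [u1], [h1] as a factor, hence is linear in
    [rms].

    Why a logarithm decides: if [B] were zero, [|E| <= K x rms] would read [E^2 <= K^2 T x E'], so
    that from a point with [E > 0] on, [-1/E] would grow at least like [ln x / (K^2 T)], which is
    impossible for a negative function. Since [B'] is bounded only after integration, this
    differential inequality is replaced by one with a weight that is a power of a logarithm. *)

Definition fconst (c : R) : R3 -> R := fun _ => c.
Definition fadd (f g : R3 -> R) : R3 -> R := fun p => f p + g p.
Definition fmul (f g : R3 -> R) : R3 -> R := fun p => f p * g p.
Definition fscal (c : R) (f : R3 -> R) : R3 -> R := fun p => c * f p.

Definition C1_field (f : R3 -> R) : Prop :=
  (forall (d : dir) (p : R3),
     ex_derive (fun t => f (upd d p t)) (coord d p)) /\
  (forall p : R3, continuous f p).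

(** The new derivative is taken innermost, whereas [iter_pd] puts it outermost. In this order the
    Leibniz rule turns [pd d (fmul f g)] into a sum of products of lower order, and induction on [n]
    closes. *)
Fixpoint Cn_field (n : nat) (f : R3 -> R) : Prop :=
  match n with
  | O => C1_field f
  | S m => C1_field f /\ forall d, Cn_field m (pd d f)
  end.

Lemma upd_upd d p s t : upd d (upd d p s) t = upd d p t.
Proof. destruct p as [[x y] z]; destruct d; reflexivity. Qed.

Lemma coord_upd d p t : coord d (upd d p t) = t.
Proof. destruct p as [[x y] z]; destruct d; reflexivity. Qed.

Lemma upd_coord d p : upd d p (coord d p) = p.
Proof. destruct p as [[x y] z]; destruct d; reflexivity. Qed.

Lemma iter_pd_app l d f : iter_pd (l ++ d :: nil) f = iter_pd l (pd d f).
Proof. induction l as [|e l IH]; simpl; [reflexivity | now rewrite IH]. Qed.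

Lemma smooth_C1 f : smooth f -> C1_field f.
Proof. intros H. exact (H nil). Qed.

Lemma smooth_pd d f : smooth f -> smooth (pd d f).
Proof. intros H l. rewrite <- iter_pd_app. apply H. Qed.

Lemma smooth_iff_Cn f : smooth f <-> forall n, Cn_field n f.
Proof.
  split.
  - intros H n; revert f H; induction n as [|n IH]; intros f H; simpl.
    + now apply smooth_C1.
    + split; [now apply smooth_C1 | intros d; now apply IH, smooth_pd].
  - intros H l; revert f H; induction l as [|d l IH] using rev_ind;
      intros f H.
    + exact (H O).
    + rewrite iter_pd_app. apply IH. intros n. now apply (H (S n)).
Qed.

Lemma Cn_pred n f : Cn_field (S n) f -> Cn_field n f.
Proof.
  revert f; induction n as [|n IH]; intros f [H1 H2]; simpl.
  - exact H1.
  - split; [exact H1 | intros d; apply IH, H2].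
Qed.

Lemma is_derive_upd f d p t : C1_field f ->
  is_derive (fun s => f (upd d p s)) t (pd d f (upd d p t)).
Proof.
  intros [H _]. unfold pd.
  generalize (Derive_correct _ _ (H d (upd d p t))).
  rewrite coord_upd. intros K.
  erewrite (Derive_ext _ _ t) in K by (intros s; now rewrite upd_upd).
  erewrite (Derive_ext _ _ t) by (intros s; now rewrite upd_upd).
  eapply is_derive_ext; [|exact K]. intros s; simpl. now rewrite upd_upd.
Qed.

Lemma pd_eq f d p l :
  is_derive (fun t => f (upd d p t)) (coord d p) l -> pd d f p = l.
Proof. apply is_derive_unique. Qed.

Lemma is_derive_pd f d p : C1_field f ->
  is_derive (fun t => f (upd d p t)) (coord d p) (pd d f p).
Proof.
  intros H. generalize (is_derive_upd f d p (coord d p) H).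
  now rewrite upd_coord.
Qed.

Lemma C1_const c : C1_field (fconst c).
Proof.
  split; intros;
    [apply (ex_derive_const (V := R_NormedModule) c) | apply continuous_const].
Qed.

Lemma C1_add f g : C1_field f -> C1_field g -> C1_field (fadd f g).
Proof.
  intros [F1 F2] [G1 G2]; split; intros.
  - apply (ex_derive_plus (fun t => f (upd d p t)) (fun t => g (upd d p t)));
      auto.
  - apply (continuous_plus (V := R_NormedModule)); auto.
Qed.

Lemma C1_mul f g : C1_field f -> C1_field g -> C1_field (fmul f g).
Proof.
  intros [F1 F2] [G1 G2]; split; intros.
  - apply (ex_derive_mult (fun t => f (upd d p t)) (fun t => g (upd d p t)));
      auto.
  - apply (continuous_mult (K := R_AbsRing)); auto.
Qed.

Lemma pd_const d c : pd d (fconst c) = fconst 0.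
Proof.
  extensionality p. apply pd_eq, (is_derive_const (V := R_NormedModule) c).
Qed.

Lemma pd_add_C1 d f g : C1_field f -> C1_field g ->
  pd d (fadd f g) = fadd (pd d f) (pd d g).
Proof.
  intros F G. extensionality p. apply pd_eq.
  apply (is_derive_plus (fun t => f (upd d p t)) (fun t => g (upd d p t)));
    now apply is_derive_pd.
Qed.

Lemma pd_mul_C1 d f g : C1_field f -> C1_field g ->
  pd d (fmul f g) = fadd (fmul (pd d f) g) (fmul f (pd d g)).
Proof.
  intros F G. extensionality p. unfold fadd, fmul, pd at 1.
  rewrite Derive_mult; [now rewrite upd_coord | |]; [apply F | apply G].
Qed.

Lemma fscal_fmul c f : fscal c f = fmul (fconst c) f.
Proof. reflexivity. Qed.

Lemma smooth_const c : smooth (fconst c).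
Proof.
  apply smooth_iff_Cn. intros n; revert c; induction n as [|n IH]; intros c.
  - apply C1_const.
  - split; [apply C1_const | intros d; rewrite pd_const; apply IH].
Qed.

Lemma Cn_add n f g : Cn_field n f -> Cn_field n g -> Cn_field n (fadd f g).
Proof.
  revert f g; induction n as [|n IH]; intros f g; [apply C1_add|].
  intros [F1 F2] [G1 G2]. split; [now apply C1_add|].
  intros d; rewrite pd_add_C1; auto.
Qed.

Lemma Cn_mul n f g : Cn_field n f -> Cn_field n g -> Cn_field n (fmul f g).
Proof.
  revert f g; induction n as [|n IH]; intros f g; [apply C1_mul|].
  intros F G. assert (F' := Cn_pred _ _ F). assert (G' := Cn_pred _ _ G).
  destruct F as [F1 F2], G as [G1 G2]. split; [now apply C1_mul|].
  intros d; rewrite pd_mul_C1 by assumption. apply Cn_add; auto.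
Qed.

Lemma smooth_add f g : smooth f -> smooth g -> smooth (fadd f g).
Proof.
  rewrite !smooth_iff_Cn. intros F G n. now apply Cn_add.
Qed.

Lemma smooth_mul f g : smooth f -> smooth g -> smooth (fmul f g).
Proof.
  rewrite !smooth_iff_Cn. intros F G n. now apply Cn_mul.
Qed.

Lemma smooth_scal c f : smooth f -> smooth (fscal c f).
Proof. intros F. apply (smooth_mul (fconst c)); auto using smooth_const. Qed.

Lemma pd_coord d e :
  pd d (coord e) = fconst match d, e with
                          | D1, D1 | D2, D2 | D3, D3 => 1
                          | _, _ => 0 end.
Proof.
  extensionality p. apply pd_eq. destruct p as [[x y] z].
  destruct d, e; simpl; unfold fconst;
    first [apply (is_derive_id (K := R_AbsRing))
          | apply (is_derive_const (V := R_NormedModule))].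
Qed.

Lemma continuous_coord d p : continuous (coord d) p.
Proof.
  destruct p as [[x y] z].
  assert (Hf : forall q : R3, continuous (fst : R3 -> R * R) q)
    by (intros q; apply continuous_fst).
  destruct d.
  - apply continuous_ext with (fun q : R3 => fst (fst q));
      [now intros [[? ?] ?]|].
    apply (continuous_comp (fst : R3 -> R * R) fst); [apply Hf|].
    apply continuous_fst.
  - apply continuous_ext with (fun q : R3 => snd (fst q));
      [now intros [[? ?] ?]|].
    apply (continuous_comp (fst : R3 -> R * R) snd); [apply Hf|].
    apply continuous_snd.
  - apply continuous_ext with (fun q : R3 => snd q);
      [now intros [[? ?] ?]|]. apply continuous_snd.
Qed.

Lemma smooth_coord e : smooth (coord e).
Proof.
  apply smooth_iff_Cn.
  assert (H : C1_field (coord e)).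
  { split; [|apply continuous_coord]. intros d [[x y] z].
    destruct d, e; simpl; auto_derive; auto. }
  intros [|n]; [exact H|]. split; [exact H|]. intros d. rewrite pd_coord.
  apply smooth_iff_Cn, smooth_const.
Qed.

Lemma pd_add d f g : smooth f -> smooth g ->
  pd d (fadd f g) = fadd (pd d f) (pd d g).
Proof. intros; apply pd_add_C1; now apply smooth_C1. Qed.

Lemma pd_mul d f g : smooth f -> smooth g ->
  pd d (fmul f g) = fadd (fmul (pd d f) g) (fmul f (pd d g)).
Proof. intros; apply pd_mul_C1; now apply smooth_C1. Qed.

Lemma pd_scal d c f : smooth f -> pd d (fscal c f) = fscal c (pd d f).
Proof.
  intros F. rewrite fscal_fmul, pd_mul, pd_const by auto using smooth_const.
  extensionality p. unfold fadd, fmul, fconst, fscal. ring.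
Qed.

(** * Symmetry of mixed partial derivatives *)

Lemma continuity_2d_slices (f : R3 -> R) (a b c : R -> R -> R) x y :
  (forall p, continuous f p) ->
  continuity_2d_pt a x y -> continuity_2d_pt b x y -> continuity_2d_pt c x y ->
  continuity_2d_pt (fun s t => f (a s t, b s t, c s t)) x y.
Proof.
  intros F A B C. rewrite continuity_2d_pt_filterlim in A, B, C.
  apply continuity_2d_pt_filterlim.
  apply (continuous_comp
    (fun q : R * R => (a (fst q) (snd q), b (fst q) (snd q), c (fst q) (snd q)))
    f (x, y)); [|apply F].
  apply (continuous_comp_2 (fun q : R * R => (a (fst q) (snd q), b (fst q) (snd q)))
    (fun q : R * R => c (fst q) (snd q)) (fun u v => (u, v)) (x, y)).
  - apply (continuous_comp_2 (fun q : R * R => a (fst q) (snd q))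
      (fun q : R * R => b (fst q) (snd q)) (fun u v => (u, v)) (x, y)); auto.
    apply continuous_ext with (fun q : R * R => q);
      [now intros [? ?] | apply continuous_id].
  - exact C.
  - apply continuous_ext with (fun q : R3 => q);
      [now intros [? ?] | apply continuous_id].
Qed.

(** The hypotheses on [upd] express that [d] and [e] are different directions. They hold by
    computation for each concrete pair, so Schwarz's theorem is applied once for all six pairs. *)
Lemma schwarz_upd f d e p : smooth f ->
  (forall s t, upd e (upd d p s) t = upd d (upd e p t) s) ->
  (forall s t u v, upd d (upd d (upd e p t) s) v = upd d (upd e p t) v /\
                   upd e (upd d (upd e p t) s) u = upd d (upd e p u) s) ->
  (forall q x y, (forall p, continuous q p) ->
     continuity_2d_pt (fun s t => q (upd d (upd e p t) s)) x y) ->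
  pd d (pd e f) p = pd e (pd d f) p.
Proof.
  intros F Hc Hu Hq.
  set (phi := fun s t => f (upd d (upd e p t) s)).
  assert (D1 : forall s t, is_derive (fun z => phi z t) s
                (pd d f (upd d (upd e p t) s))).
  { intros s t. unfold phi. apply is_derive_upd, smooth_C1, F. }
  assert (D2' : forall g s t, smooth g ->
     is_derive (fun z => g (upd d (upd e p z) s)) t
                (pd e g (upd d (upd e p t) s))).
  { intros g s t G. rewrite <- Hc.
    eapply is_derive_ext; [|apply is_derive_upd, smooth_C1, G].
    intros z; simpl. now rewrite Hc. }
  assert (E1 : forall s t, Derive (fun z => phi z t) s
                 = pd d f (upd d (upd e p t) s))
    by (intros; apply is_derive_unique, D1).
  assert (E2 : forall s t, Derive (fun z => phi s z) t
                 = pd e f (upd d (upd e p t) s))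
    by (intros; now apply is_derive_unique, D2').
  assert (E12 : forall s t, Derive (fun z => Derive (fun t => phi z t) t) s
                 = pd d (pd e f) (upd d (upd e p t) s)).
  { intros s t. rewrite (Derive_ext _ (fun z => pd e f (upd d (upd e p t) z)))
      by (intros; apply E2).
    apply is_derive_unique, is_derive_upd, smooth_C1, smooth_pd, F. }
  assert (E21 : forall s t, Derive (fun z => Derive (fun s => phi s z) s) t
                 = pd e (pd d f) (upd d (upd e p t) s)).
  { intros s t. rewrite (Derive_ext _ (fun z => pd d f (upd d (upd e p z) s)))
      by (intros; apply E1).
    apply is_derive_unique, D2', smooth_pd, F. }
  assert (S := Schwarz phi (coord d p) (coord e p)).
  rewrite E12, E21, !upd_coord in S. apply S; clear S.
  - exists (mkposreal 1 Rlt_0_1). intros s t _ _. split; [|split; [|split]].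
    + eexists; apply D1.
    + eexists; now apply D2'.
    + apply ex_derive_ext with (fun z => pd e f (upd d (upd e p t) z));
        [intros z; now rewrite E2|].
      eexists; apply is_derive_upd, smooth_C1, smooth_pd, F.
    + apply ex_derive_ext with (fun z => pd d f (upd d (upd e p z) s));
        [intros z; now rewrite E1|].
      eexists; apply D2', smooth_pd, F.
  - apply continuity_2d_pt_ext with
      (fun s t => pd d (pd e f) (upd d (upd e p t) s));
      [intros; now rewrite E12|].
    apply Hq, (smooth_C1 _ (smooth_pd d _ (smooth_pd e _ F))).
  - apply continuity_2d_pt_ext with
      (fun s t => pd e (pd d f) (upd d (upd e p t) s));
      [intros; now rewrite E21|].
    apply Hq, (smooth_C1 _ (smooth_pd e _ (smooth_pd d _ F))).
Qed.

Lemma pd_comm d e f : smooth f -> pd d (pd e f) = pd e (pd d f).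
Proof.
  intros F. destruct d, e; try reflexivity; extensionality p;
    apply schwarz_upd; auto; destruct p as [[x y] z]; simpl; auto;
    intros q s t Q; apply (continuity_2d_slices q); auto;
    first [ apply continuity_2d_pt_id1 | apply continuity_2d_pt_id2
          | apply continuity_2d_pt_const ].
Qed.

(** * The chain rule along a curve *)

Lemma ex_MVT_point (f f' : R -> R) (a b : R) :
  (forall t, is_derive f t (f' t)) ->
  exists c, Rabs (c - a) <= Rabs (b - a) /\ f b - f a = f' c * (b - a).
Proof.
  intros H.
  destruct (MVT_gen f a b f') as [c [C E]].
  - intros x _; apply H.
  - intros x _. apply continuity_pt_filterlim.
    apply (ex_derive_continuous (V := R_NormedModule)). eexists; apply H.
  - exists c. split; [|exact E].
    unfold Rmin, Rmax in C. destruct (Rle_dec a b);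
      unfold Rabs; repeat destruct Rcase_abs; lra.
Qed.

(** Meant for intermediate points of the mean value theorem: they are chosen arbitrarily for each
    parameter, but being trapped by [a] they are continuous at [t0]. *)
Lemma continuous_squeeze (x a : R -> R) t0 :
  continuous a t0 -> (forall t, Rabs (x t - a t0) <= Rabs (a t - a t0)) ->
  x t0 = a t0 /\ continuous x t0.
Proof.
  intros A H.
  assert (E : x t0 = a t0).
  { specialize (H t0). rewrite Rminus_diag, Rabs_R0 in H.
    generalize (Rabs_pos (x t0 - a t0)); intros.
    apply Rminus_diag_uniq. destruct (Req_dec (x t0 - a t0) 0); auto.
    apply Rabs_pos_lt in H1. lra. }
  split; auto.
  apply filterlim_locally. intros eps. rewrite E.
  generalize (proj1 (filterlim_locally _ _) A eps).
  apply filter_imp. intros t Ht. eapply Rle_lt_trans; [apply H | exact Ht].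
Qed.

(** Caratheodory's form of the chain rule. The slope [k] is asked to be continuous at [t0] only,
    which suits slopes evaluated at chosen intermediate points. *)
Lemma is_derive_caratheodory (F k a : R -> R) t0 l :
  continuous k t0 -> is_derive a t0 l ->
  (forall t, F t = F t0 + k t * (a t - a t0)) ->
  is_derive F t0 (k t0 * l).
Proof.
  intros K A H.
  apply is_derive_ext with (fun t => F t0 + k t * (a t - a t0)); [auto|].
  replace (k t0 * l) with (plus 0 (k t0 * l)) by apply Rplus_0_l.
  apply (is_derive_plus (V := R_NormedModule) (fun _ => F t0));
    [apply (is_derive_const (V := R_NormedModule))|].
  apply is_derive_Reals. apply is_derive_Reals in A.
  intros eps Heps.
  assert (Hm : 0 < Rabs (k t0) + 1) by (generalize (Rabs_pos (k t0)); lra).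
  assert (Hl : 0 < Rabs l + 1) by (generalize (Rabs_pos l); lra).
  set (e1 := eps / 2 / (Rabs (k t0) + 1)).
  assert (He1 : 0 < e1) by (unfold e1; repeat apply Rdiv_lt_0_compat; lra).
  assert (E1 : e1 * (Rabs (k t0) + 1) = eps / 2) by (unfold e1; field; lra).
  set (e2 := eps / 2 / (Rabs l + 1 + e1)).
  assert (He2 : 0 < e2) by (unfold e2; repeat apply Rdiv_lt_0_compat; lra).
  assert (E2 : e2 * (Rabs l + 1 + e1) = eps / 2) by (unfold e2; field; lra).
  destruct (A _ He1) as [d1 D1].
  destruct (proj1 (filterlim_locally _ _) K (mkposreal _ He2)) as [d2 D2].
  exists (mkposreal _ (Rmin_stable_in_posreal d1 d2)). simpl.
  intros h Hh Hd.
  specialize (D1 h Hh (Rlt_le_trans _ _ _ Hd (Rmin_l _ _))).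
  assert (D2' : Rabs (k (t0 + h) - k t0) < e2).
  { apply (D2 (t0 + h)). unfold ball; simpl; unfold AbsRing_ball; simpl.
    unfold abs, minus, plus, opp; simpl.
    replace (t0 + h + - t0) with h by ring.
    exact (Rlt_le_trans _ _ _ Hd (Rmin_r _ _)). }
  rewrite Rminus_diag, Rmult_0_r, Rminus_0_r.
  set (q := (a (t0 + h) - a t0) / h) in *.
  replace (k (t0 + h) * (a (t0 + h) - a t0) / h - k t0 * l)
    with ((k (t0 + h) - k t0) * (l + (q - l)) + k t0 * (q - l))
    by (unfold q; field; auto).
  eapply Rle_lt_trans; [apply Rabs_triang|]. rewrite !Rabs_mult.
  assert (B : Rabs (l + (q - l)) <= Rabs l + e1)
    by (eapply Rle_trans; [apply Rabs_triang | lra]).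
  generalize (Rabs_pos (k (t0 + h) - k t0)) (Rabs_pos (l + (q - l)))
    (Rabs_pos (k t0)) (Rabs_pos (q - l)) (Rabs_pos l). intros.
  assert (Rabs (k (t0 + h) - k t0) * Rabs (l + (q - l)) <= e2 * (Rabs l + e1))
    by (apply Rmult_le_compat; lra).
  assert (Rabs (k t0) * Rabs (q - l) <= Rabs (k t0) * e1)
    by (apply Rmult_le_compat_l; lra).
  nra.
Qed.

Lemma continuous_R3 (a b c : R -> R) t :
  continuous a t -> continuous b t -> continuous c t ->
  continuous (fun s => (a s, b s, c s) : R3) t.
Proof.
  intros A B C.
  apply (continuous_comp_2 (fun s => (a s, b s)) c (fun u v => (u, v)) t); auto.
  - apply (continuous_comp_2 a b (fun u v => (u, v)) t); auto.
    apply continuous_ext with (fun q : R * R => q);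
      [now intros [? ?] | apply continuous_id].
  - apply continuous_ext with (fun q : R3 => q);
      [now intros [? ?] | apply continuous_id].
Qed.

(** The increment of [f] is telescoped through one coordinate at a time. The mean value theorem
    turns each piece into a partial derivative at an intermediate point times the increment of one
    coordinate, and [is_derive_caratheodory] applies to each piece. *)
Lemma chain_R3 (f : R3 -> R) (a b c : R -> R) t la lb lc : smooth f ->
  is_derive a t la -> is_derive b t lb -> is_derive c t lc ->
  is_derive (fun s => f (a s, b s, c s)) t
    (pd D1 f (a t, b t, c t) * la + pd D2 f (a t, b t, c t) * lb
     + pd D3 f (a t, b t, c t) * lc).
Proof.
  intros F A B C.
  assert (Ac : continuous a t)
    by (apply (ex_derive_continuous (V := R_NormedModule)); eexists; eauto).
  assert (Bc : continuous b t)
    by (apply (ex_derive_continuous (V := R_NormedModule)); eexists; eauto).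
  assert (Cc : continuous c t)
    by (apply (ex_derive_continuous (V := R_NormedModule)); eexists; eauto).
  assert (FC := smooth_C1 _ F).
  destruct (functional_choice (fun s w => Rabs (w - a t) <= Rabs (a s - a t) /\
     f (a s, b s, c s) - f (a t, b s, c s)
     = pd D1 f (w, b s, c s) * (a s - a t))) as [wa Wa].
  { intros s. apply (ex_MVT_point (fun w => f (w, b s, c s))
      (fun w => pd D1 f (w, b s, c s))).
    intros w. exact (is_derive_upd f D1 (0, b s, c s) w FC). }
  destruct (functional_choice (fun s w => Rabs (w - b t) <= Rabs (b s - b t) /\
     f (a t, b s, c s) - f (a t, b t, c s)
     = pd D2 f (a t, w, c s) * (b s - b t))) as [wb Wb].
  { intros s. apply (ex_MVT_point (fun w => f (a t, w, c s))
      (fun w => pd D2 f (a t, w, c s))).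
    intros w. exact (is_derive_upd f D2 (a t, 0, c s) w FC). }
  destruct (functional_choice (fun s w => Rabs (w - c t) <= Rabs (c s - c t) /\
     f (a t, b t, c s) - f (a t, b t, c t)
     = pd D3 f (a t, b t, w) * (c s - c t))) as [wc Wc].
  { intros s. apply (ex_MVT_point (fun w => f (a t, b t, w))
      (fun w => pd D3 f (a t, b t, w))).
    intros w. exact (is_derive_upd f D3 (a t, b t, 0) w FC). }
  destruct (continuous_squeeze wa a t Ac (fun s => proj1 (Wa s))) as [Ea Ka].
  destruct (continuous_squeeze wb b t Bc (fun s => proj1 (Wb s))) as [Eb Kb].
  destruct (continuous_squeeze wc c t Cc (fun s => proj1 (Wc s))) as [Ec Kc].
  assert (K : forall d (x y z : R -> R), continuous x t -> continuous y t ->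
     continuous z t -> continuous (fun s => pd d f (x s, y s, z s)) t).
  { intros d x y z X Y Z.
    apply (continuous_comp (fun s => (x s, y s, z s) : R3) (pd d f)).
    - now apply continuous_R3.
    - apply (smooth_C1 _ (smooth_pd d f F)). }
  apply is_derive_ext with (fun s =>
    (pd D1 f (wa s, b s, c s) * (a s - a t)
     + pd D2 f (a t, wb s, c s) * (b s - b t))
    + (f (a t, b t, c t) + pd D3 f (a t, b t, wc s) * (c s - c t))).
  { intros s. destruct (Wa s) as [_ H1], (Wb s) as [_ H2], (Wc s) as [_ H3].
    simpl. unfold R3 in *. lra. }
  apply (is_derive_plus (V := R_NormedModule));
    [apply (is_derive_plus (V := R_NormedModule))|].
  - rewrite <- Ea at 1.
    apply (is_derive_caratheodory _ (fun s => pd D1 f (wa s, b s, c s)) a);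
      [apply K; auto | auto | intros; ring].
  - rewrite <- Eb at 1.
    apply (is_derive_caratheodory _ (fun s => pd D2 f (a t, wb s, c s)) b);
      [apply (K D2 (fun _ => a t)); auto using continuous_const | auto | intros; ring].
  - rewrite <- Ec at 1.
    apply (is_derive_caratheodory _ (fun s => pd D3 f (a t, b t, wc s)) c);
      [apply (K D3 (fun _ => a t) (fun _ => b t)); auto using continuous_const
      | auto | intros; ring].
Qed.

(** * Infinitesimal helical symmetry *)

Create HintDb smooth.
#[global] Hint Resolve smooth_const smooth_add smooth_mul smooth_scal smooth_coord
  smooth_pd : smooth.

Ltac sm := auto 12 with smooth.
Ltac pd_simpl :=
  repeat first [ rewrite pd_add by sm | rewrite pd_mul by sm
               | rewrite pd_scal by sm | rewrite pd_const | rewrite pd_coord ].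

(** The derivative along [(y, -x, sigma)], the velocity of [Shel sigma rho] at [rho = 0]. *)
Definition Lie (sigma : R) (f : R3 -> R) : R3 -> R :=
  fadd (fmul (coord D2) (pd D1 f))
    (fadd (fscal (-1) (fmul (coord D1) (pd D2 f))) (fscal sigma (pd D3 f))).

Definition lap (f : R3 -> R) : R3 -> R :=
  fadd (pd D1 (pd D1 f)) (fadd (pd D2 (pd D2 f)) (pd D3 (pd D3 f))).

Definition grad (f : R3 -> R) : dir -> R3 -> R := fun d => pd d f.

Definition dot (V W : dir -> R3 -> R) : R3 -> R :=
  fadd (fmul (V D1) (W D1)) (fadd (fmul (V D2) (W D2)) (fmul (V D3) (W D3))).

Definition dv (V : dir -> R3 -> R) : R3 -> R :=
  fadd (pd D1 (V D1)) (fadd (pd D2 (V D2)) (pd D3 (V D3))).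

Definition vadd (V W : dir -> R3 -> R) : dir -> R3 -> R :=
  fun d => fadd (V d) (W d).

Definition vmul (s : R3 -> R) (V : dir -> R3 -> R) : dir -> R3 -> R :=
  fun d => fmul s (V d).

Ltac field_ext :=
  extensionality p;
  unfold Lie, lap, dot, dv, vadd, vmul, grad, fadd, fmul, fscal, fconst; ring.

Lemma smooth_Lie sigma f : smooth f -> smooth (Lie sigma f).
Proof. intros; unfold Lie; sm. Qed.

Lemma smooth_lap f : smooth f -> smooth (lap f).
Proof. intros; unfold lap; sm. Qed.

Lemma smooth_dot V W : (forall d, smooth (V d)) -> (forall d, smooth (W d)) ->
  smooth (dot V W).
Proof. intros; unfold dot; sm. Qed.

Lemma smooth_dv V : (forall d, smooth (V d)) -> smooth (dv V).
Proof. intros; unfold dv; sm. Qed.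

Lemma smooth_grad f d : smooth f -> smooth (grad f d).
Proof. apply smooth_pd. Qed.
#[global] Hint Resolve smooth_Lie smooth_lap smooth_dot smooth_dv smooth_grad : smooth.

Section Invariance.
Context (sigma : R).
Local Notation L := (Lie sigma).

Lemma Lie_add f g : smooth f -> smooth g -> L (fadd f g) = fadd (L f) (L g).
Proof. intros F G. unfold Lie. pd_simpl. field_ext. Qed.

Lemma Lie_mul f g : smooth f -> smooth g ->
  L (fmul f g) = fadd (fmul (L f) g) (fmul f (L g)).
Proof. intros F G. unfold Lie. pd_simpl. field_ext. Qed.

Lemma Lie_scal c f : smooth f -> L (fscal c f) = fscal c (L f).
Proof. intros F. unfold Lie. pd_simpl. field_ext. Qed.

Lemma Lie_const c : L (fconst c) = fconst 0.
Proof. unfold Lie. pd_simpl. field_ext. Qed.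

(** The commutator of [L] with the gradient is the infinitesimal rotation that appears in
    [equivariant]. Hence gradients of invariant functions are equivariant, and in the Laplacian the
    commutators cancel. *)
Lemma Lie_pd1 f : smooth f -> L (pd D1 f) = fadd (pd D1 (L f)) (pd D2 f).
Proof.
  intros F. unfold Lie. pd_simpl.
  rewrite (pd_comm D1 D2 f F), (pd_comm D1 D3 f F). field_ext.
Qed.

Lemma Lie_pd2 f : smooth f ->
  L (pd D2 f) = fadd (pd D2 (L f)) (fscal (-1) (pd D1 f)).
Proof.
  intros F. unfold Lie. pd_simpl.
  rewrite (pd_comm D2 D1 f F), (pd_comm D2 D3 f F). field_ext.
Qed.

Lemma Lie_pd3 f : smooth f -> L (pd D3 f) = pd D3 (L f).
Proof.
  intros F. unfold Lie. pd_simpl.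
  rewrite (pd_comm D3 D1 f F), (pd_comm D3 D2 f F). field_ext.
Qed.

Lemma Lie_lap f : smooth f -> L (lap f) = lap (L f).
Proof.
  intros F. unfold lap. rewrite !Lie_add by sm.
  rewrite Lie_pd1, Lie_pd2, Lie_pd3 by sm.
  rewrite (Lie_pd1 f), (Lie_pd2 f), (Lie_pd3 f) by sm. pd_simpl.
  rewrite (pd_comm D2 D1 f F). field_ext.
Qed.

Definition invariant (f : R3 -> R) : Prop := smooth f /\ L f = fconst 0.

(** The derivative at [rho = 0] of the helical symmetry of a vector field; the right-hand sides are
    the derivative of [Rrot rho] applied to [V]. *)
Definition equivariant (V : dir -> R3 -> R) : Prop :=
  (forall d, smooth (V d)) /\
  L (V D1) = V D2 /\ L (V D2) = fscal (-1) (V D1) /\ L (V D3) = fconst 0.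

Lemma invariant_add f g : invariant f -> invariant g -> invariant (fadd f g).
Proof.
  intros [F1 F2] [G1 G2]; split; [sm|]. rewrite Lie_add, F2, G2 by sm. field_ext.
Qed.

Lemma invariant_scal c f : invariant f -> invariant (fscal c f).
Proof.
  intros [F1 F2]; split; [sm|]. rewrite Lie_scal, F2 by sm. field_ext.
Qed.

Lemma invariant_dot V W : equivariant V -> equivariant W -> invariant (dot V W).
Proof.
  intros [V0 [V1 [V2 V3]]] [W0 [W1 [W2 W3]]]; split; [sm|].
  unfold dot. rewrite !Lie_add by sm. rewrite !Lie_mul by sm.
  rewrite V1, V2, V3, W1, W2, W3. field_ext.
Qed.

Lemma invariant_D3 V : equivariant V -> invariant (V D3).
Proof. intros [V0 [V1 [V2 V3]]]; now split. Qed.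

Lemma equivariant_add V W :
  equivariant V -> equivariant W -> equivariant (vadd V W).
Proof.
  intros [V0 [V1 [V2 V3]]] [W0 [W1 [W2 W3]]]; unfold vadd.
  split; [sm | split; [|split]]; rewrite Lie_add by sm;
    rewrite ?V1, ?V2, ?V3, ?W1, ?W2, ?W3; field_ext.
Qed.

Lemma equivariant_mul s V : invariant s -> equivariant V -> equivariant (vmul s V).
Proof.
  intros [S0 S1] [V0 [V1 [V2 V3]]]; unfold vmul.
  split; [sm | split; [|split]]; rewrite Lie_mul by sm;
    rewrite S1, ?V1, ?V2, ?V3; field_ext.
Qed.

Lemma equivariant_grad f : invariant f -> equivariant (grad f).
Proof.
  intros [F0 F1]; unfold grad. split; [sm | split; [|split]].
  - rewrite Lie_pd1, F1, pd_const by sm. field_ext.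
  - rewrite Lie_pd2, F1, pd_const by sm. field_ext.
  - rewrite Lie_pd3, F1, pd_const by sm. field_ext.
Qed.

Lemma lap_scal c f : smooth f -> lap (fscal c f) = fscal c (lap f).
Proof. intros F. unfold lap. pd_simpl. field_ext. Qed.

Lemma equivariant_lap V : equivariant V -> equivariant (fun d => lap (V d)).
Proof.
  intros [V0 [V1 [V2 V3]]]. split; [sm | split; [|split]]; rewrite Lie_lap by sm.
  - now rewrite V1.
  - now rewrite V2, lap_scal by sm.
  - rewrite V3. unfold lap. pd_simpl. field_ext.
Qed.

(** The rotation of [V] cancels the commutator of [L] with the gradient. *)
Lemma Lie_adv V f : equivariant V -> smooth f ->
  L (dot V (grad f)) = dot V (grad (L f)).
Proof.
  intros [V0 [V1 [V2 V3]]] F. unfold dot, grad. rewrite !Lie_add by sm.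
  rewrite !Lie_mul by sm. rewrite Lie_pd1, Lie_pd2, Lie_pd3 by sm.
  rewrite V1, V2, V3. field_ext.
Qed.

Lemma equivariant_adv V W : equivariant V -> equivariant W ->
  equivariant (fun d => dot V (grad (W d))).
Proof.
  intros HV [W0 [W1 [W2 W3]]]. assert (V0 := proj1 HV).
  split; [sm | split; [|split]]; rewrite Lie_adv by sm.
  - now rewrite W1.
  - rewrite W2. unfold dot, grad. pd_simpl. field_ext.
  - rewrite W3. unfold dot, grad. pd_simpl. field_ext.
Qed.

(** Used for the pressure, of which only the gradient is known: its Lie derivative is then a
    constant, still to be determined. *)
Lemma pd_Lie_zero f : equivariant (grad f) -> smooth f ->
  forall d, pd d (L f) = fconst 0.
Proof.
  intros [_ [G1 [G2 G3]]] F d; unfold grad in *.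
  rewrite Lie_pd1 in G1 by sm. rewrite Lie_pd2 in G2 by sm.
  rewrite Lie_pd3 in G3 by sm.
  extensionality p. apply (f_equal (fun g => g p)) in G1, G2, G3.
  unfold fadd, fscal, fconst in *. destruct d; lra.
Qed.

Lemma Lie_helical (u : R3 -> R3) : smooth_vf u -> helically_symmetric sigma u ->
  equivariant (fun d => comp d u).
Proof.
  intros S H. split; [exact S|].
  assert (D : forall f p, smooth f ->
     is_derive (fun t => f (Shel sigma t p)) 0 (L f p)).
  { intros f [[x y] z] F. unfold Shel, Rrot.
    assert (E : forall l, l = L f (x, y, z) -> is_derive
      (fun t => f (cos t * x + sin t * y, - sin t * x + cos t * y, z + sigma * t))
      0 l -> is_derive
      (fun t => f (cos t * x + sin t * y, - sin t * x + cos t * y, z + sigma * t))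
      0 (L f (x, y, z))) by (now intros l ->).
    eapply E; [|apply (chain_R3 f (fun t => cos t * x + sin t * y)
      (fun t => - sin t * x + cos t * y) (fun t => z + sigma * t) 0
      y (- x) sigma); auto; auto_derive; auto].
    - rewrite cos_0, sin_0.
      replace (1 * x + 0 * y) with x by ring.
      replace (- 0 * x + 1 * y) with y by ring.
      replace (z + sigma * 0) with z by ring.
      unfold Lie, fadd, fmul, fscal; simpl. ring.
    - rewrite cos_0, sin_0. ring.
    - rewrite cos_0, sin_0. ring.
    - ring. }
  assert (K : forall d p l, is_derive (fun t => coord d (Rrot t (u p))) 0 l ->
     L (comp d u) p = l).
  { intros d p l Hl. eapply is_derive_unique in Hl.
    rewrite <- Hl. symmetry. apply is_derive_unique.
    eapply is_derive_ext; [|apply (D (comp d u) p (S d))].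
    intros t. unfold comp. now rewrite H. }
  split; [|split]; extensionality p; apply K; unfold comp, fscal, fconst;
    destruct (u p) as [[a b] c]; simpl; auto_derive; auto;
    rewrite cos_0, sin_0; ring.
Qed.

End Invariance.

Lemma dv_add V W : (forall d, smooth (V d)) -> (forall d, smooth (W d)) ->
  dv (vadd V W) = fadd (dv V) (dv W).
Proof. intros. unfold dv, vadd. pd_simpl. field_ext. Qed.

Lemma dv_mul s V : smooth s -> (forall d, smooth (V d)) ->
  dv (vmul s V) = fadd (dot V (grad s)) (fmul s (dv V)).
Proof. intros. unfold dv, vmul. pd_simpl. field_ext. Qed.

(** * Periodicity in the axial variable *)

Definition periodic (T : R) (f : R3 -> R) : Prop :=
  forall x y z, f (x, y, z + T) = f (x, y, z).

Lemma is_derive_shift3 f T d x y z t : smooth f ->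
  is_derive (fun s => let '(a, b, c) := upd d (x, y, z) s in f (a, b, c + T)) t
    (let '(a, b, c) := upd d (x, y, z) t in pd d f (a, b, c + T)).
Proof.
  intros F. destruct d; simpl.
  - exact (is_derive_upd f D1 (x, y, z + T) t (smooth_C1 _ F)).
  - exact (is_derive_upd f D2 (x, y, z + T) t (smooth_C1 _ F)).
  - replace (pd D3 f (x, y, t + T)) with (1 * pd D3 f (x, y, t + T)) by ring.
    apply (is_derive_comp (fun t => f (x, y, t)) (fun t => t + T) t).
    + exact (is_derive_upd f D3 (x, y, z) (t + T) (smooth_C1 _ F)).
    + auto_derive; auto.
Qed.

Lemma periodic_pd T d f : periodic T f -> smooth f -> periodic T (pd d f).
Proof.
  intros H F x y z.
  assert (K := is_derive_shift3 f T d x y z (coord d (x, y, z)) F).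
  rewrite upd_coord in K. symmetry. apply pd_eq.
  eapply is_derive_ext; [|exact K].
  intros t. destruct d; simpl; apply H.
Qed.

Lemma periodic_add T f g : periodic T f -> periodic T g -> periodic T (fadd f g).
Proof. intros F G x y z. unfold fadd. now rewrite F, G. Qed.

Lemma periodic_mul T f g : periodic T f -> periodic T g -> periodic T (fmul f g).
Proof. intros F G x y z. unfold fmul. now rewrite F, G. Qed.

Lemma periodic_scal T c f : periodic T f -> periodic T (fscal c f).
Proof. intros F x y z. unfold fscal. now rewrite F. Qed.

Lemma periodic_dot T V W : (forall d, periodic T (V d)) ->
  (forall d, periodic T (W d)) -> periodic T (dot V W).
Proof. intros; unfold dot; auto using periodic_add, periodic_mul. Qed.

Lemma constant_of_is_derive (f : R3 -> R) :
  (forall d p t, is_derive (fun s => f (upd d p s)) t 0) -> forall p q, f p = f q.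
Proof.
  intros H.
  assert (K : forall d p t s, f (upd d p t) = f (upd d p s)).
  { intros d p.
    assert (K : forall t s, t < s -> f (upd d p t) = f (upd d p s)).
    { intros t s Hts. apply (eq_is_derive (fun r => f (upd d p r)) t s); auto. }
    intros t s. destruct (Rtotal_order t s) as [|[->|]]; auto.
    symmetry; auto. }
  intros [[x y] z] [[x' y'] z'].
  rewrite (K D1 (x, y, z) x x' : f (x, y, z) = f (x', y, z)).
  rewrite (K D2 (x', y, z) y y' : f (x', y, z) = f (x', y', z)).
  exact (K D3 (x', y', z) z z').
Qed.

Lemma constant_of_pd f : smooth f -> (forall d, pd d f = fconst 0) ->
  forall p q, f p = f q.
Proof.
  intros F H. apply constant_of_is_derive. intros d p t.
  generalize (is_derive_upd f d p t (smooth_C1 _ F)). now rewrite H.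
Qed.

(** The difference between [f] and its shift has zero gradient. For the pressure, the constant is
    the pressure drop over one period. *)
Lemma shift_difference_constant f T : smooth f -> (forall d, periodic T (pd d f)) ->
  forall x y z x' y' z',
  f (x, y, z + T) - f (x, y, z) = f (x', y', z' + T) - f (x', y', z').
Proof.
  intros F P x y z x' y' z'.
  apply (constant_of_is_derive (fun p => (let '(a, b, c) := p in f (a, b, c + T)) - f p))
    with (p := (x, y, z)) (q := (x', y', z')).
  intros d [[a b] c] t.
  replace 0 with ((let '(a, b, c) := upd d (a, b, c) t in pd d f (a, b, c + T))
                  - pd d f (upd d (a, b, c) t)).
  - apply (is_derive_minus (V := R_NormedModule)
      (fun s => let '(a, b, c) := upd d (a, b, c) s in f (a, b, c + T))).
    + now apply is_derive_shift3.
    + now apply is_derive_upd, smooth_C1.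
  - destruct d; simpl; rewrite P; ring.
Qed.

(** * Averages over a period on the half-plane y = 0 *)

Lemma ex_RInt_cont (f : R -> R) a b :
  (forall z, continuous f z) -> ex_RInt f a b.
Proof. intros F. apply (ex_RInt_continuous (V := R_CompleteNormedModule)); auto. Qed.

Lemma RInt_lin (f g : R -> R) c d a b :
  (forall z, continuous f z) -> (forall z, continuous g z) ->
  RInt (fun z => c * f z + d * g z) a b = c * RInt f a b + d * RInt g a b.
Proof.
  intros F G. apply is_RInt_unique.
  apply (is_RInt_plus (V := R_NormedModule) (fun z => c * f z) (fun z => d * g z));
    apply (is_RInt_scal (V := R_NormedModule));
    apply (RInt_correct (V := R_CompleteNormedModule)), ex_RInt_cont; auto.
Qed.

Lemma RInt_constant (c a b : R) : RInt (fun _ => c) a b = c * (b - a).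
Proof. rewrite (RInt_const (V := R_CompleteNormedModule)). apply Rmult_comm. Qed.

Lemma RInt_derivative (f f' : R -> R) a b :
  (forall z, is_derive f z (f' z)) -> (forall z, continuous f' z) ->
  RInt f' a b = f b - f a.
Proof.
  intros F C. apply is_RInt_unique, (is_RInt_derive (V := R_CompleteNormedModule) f f'); auto.
Qed.

Lemma RInt_abs_le (f g : R -> R) a b : a <= b ->
  (forall z, continuous f z) -> (forall z, continuous g z) ->
  (forall z, a <= z <= b -> Rabs (f z) <= g z) -> Rabs (RInt f a b) <= RInt g a b.
Proof.
  intros H F G B.
  eapply Rle_trans; [apply abs_RInt_le; auto using ex_RInt_cont|].
  apply RInt_le; auto using ex_RInt_cont.
  - apply ex_RInt_cont. intros z. now apply continuous_Rabs_comp.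
  - intros z Hz; apply B; lra.
Qed.

Lemma RInt_nonneg (f : R -> R) a b : a <= b -> (forall z, continuous f z) ->
  (forall z, a <= z <= b -> 0 <= f z) -> 0 <= RInt f a b.
Proof.
  intros H F B. rewrite <- (Rmult_0_l (b - a)), <- RInt_constant.
  apply RInt_le; auto using ex_RInt_cont, continuous_const.
  intros z Hz; apply B; lra.
Qed.

Lemma RInt_split (f : R -> R) a b c : (forall z, continuous f z) ->
  RInt f a c = RInt f a b + RInt f b c.
Proof.
  intros F. symmetry.
  apply (RInt_Chasles (V := R_CompleteNormedModule)); now apply ex_RInt_cont.
Qed.

Lemma RInt_zero_pointwise (f : R -> R) a b : (forall z, continuous f z) ->
  (forall z, 0 <= f z) -> RInt f a b = 0 -> forall z, a < z < b -> f z = 0.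
Proof.
  intros F P E z Hz.
  destruct (Rle_lt_or_eq_dec _ _ (P z)) as [Hp|]; [exfalso|auto].
  destruct (proj1 (filterlim_locally _ _) (F z) (mkposreal _ Hp)) as [[d Hd] D].
  simpl in D.
  set (l := Rmax a (z - d / 2)). set (r := Rmin b (z + d / 2)).
  assert (a <= l) by apply Rmax_l. assert (z - d / 2 <= l) by apply Rmax_r.
  assert (r <= b) by apply Rmin_l. assert (r <= z + d / 2) by apply Rmin_r.
  assert (l < z) by (apply Rmax_lub_lt; lra).
  assert (z < r) by (apply Rmin_glb_lt; lra).
  assert (0 < RInt f l r).
  { apply RInt_gt_0; auto; [lra|]. intros s Hs.
    assert (B : ball z d s).
    { unfold ball; simpl; unfold AbsRing_ball, abs, minus, plus, opp; simpl.
      apply Rabs_def1; lra. }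
    specialize (D s B). unfold ball in D; simpl in D.
    unfold AbsRing_ball, abs, minus, plus, opp in D; simpl in D.
    apply Rabs_def2 in D. lra. }
  assert (C1 := RInt_split f a l b F). assert (C2 := RInt_split f l r b F).
  assert (0 <= RInt f a l) by (apply RInt_nonneg; auto; lra).
  assert (0 <= RInt f r b) by (apply RInt_nonneg; auto; lra).
  lra.
Qed.

Lemma cauchy_schwarz_RInt (f e : R -> R) a b M : a < b ->
  (forall z, continuous f z) -> (forall z, continuous e z) ->
  (forall z, a <= z <= b -> f z ^ 2 <= M ^ 2 * e z) ->
  (RInt f a b) ^ 2 <= M ^ 2 * ((b - a) * RInt e a b).
Proof.
  (* With [m] the mean of [f], the bound comes from integrating [(f - m)^2 >= 0] after replacing
     [f^2] by its majorant [M^2 e]. *)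
  intros H F E B. set (I := RInt f a b). set (m := I / (b - a)).
  assert (K : 0 <= RInt (fun z => 1 * (M ^ 2 * e z + (-2 * m) * f z) + 1 * m ^ 2) a b).
  { apply RInt_nonneg; [lra| |].
    - intros z.
      apply (continuous_plus (V := R_NormedModule)
        (fun z => 1 * (M ^ 2 * e z + -2 * m * f z))); [|apply continuous_const].
      apply (continuous_scal_r (V := R_NormedModule) 1).
      apply (continuous_plus (V := R_NormedModule)
        (fun z => M ^ 2 * e z) (fun z => -2 * m * f z));
        [apply (continuous_scal_r (V := R_NormedModule) (M ^ 2) e), E
        |apply (continuous_scal_r (V := R_NormedModule) (-2 * m) f), F].
    - intros z Hz. specialize (B z Hz). generalize (pow2_ge_0 (f z - m)). nra. }
  rewrite (RInt_lin (fun z => M ^ 2 * e z + (-2 * m) * f z) (fun _ => m ^ 2)),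
    RInt_lin, RInt_constant in K; auto using continuous_const.
  2:{ intros z. apply (continuous_plus (V := R_NormedModule)
        (fun z => M ^ 2 * e z) (fun z => -2 * m * f z));
        [apply (continuous_scal_r (V := R_NormedModule) (M ^ 2) e), E
        |apply (continuous_scal_r (V := R_NormedModule) (-2 * m) f), F]. }
  fold I in K.
  assert (Em : forall J : R, J = J / (b - a) * (b - a)) by (intros; field; lra).
  specialize (Em I). fold m in Em. clearbody m. clearbody I.
  rewrite Em in K |- *. nra.
Qed.

Lemma abs_RInt_le_sqrt (f e : R -> R) T M : 0 < T -> 0 <= M ->
  (forall z, continuous f z) -> (forall z, continuous e z) ->
  (forall z, 0 <= z <= T -> f z ^ 2 <= M ^ 2 * e z) ->
  Rabs (RInt f 0 T) <= M * sqrt (T * RInt e 0 T).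
Proof.
  intros H HM F E B.
  generalize (cauchy_schwarz_RInt f e 0 T M H F E B). rewrite Rminus_0_r. intros K.
  rewrite <- (sqrt_pow2 M HM), <- sqrt_mult_alt by apply pow2_ge_0.
  rewrite <- sqrt_Rsqr_abs. apply sqrt_le_1_alt. unfold Rsqr. lra.
Qed.

Lemma oscillation_bound (f f' e : R -> R) T : 0 < T ->
  (forall z, is_derive f z (f' z)) -> (forall z, continuous f' z) ->
  (forall z, continuous e z) -> (forall z, f' z ^ 2 <= e z) ->
  forall s z, 0 <= s <= T -> 0 <= z <= T ->
  Rabs (f z - f s) <= sqrt (T * RInt e 0 T).
Proof.
  intros H F F' E B.
  assert (K : forall s z, 0 <= s -> s < z -> z <= T ->
            Rabs (f z - f s) <= sqrt (T * RInt e 0 T)).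
  { intros s z Hs Hsz Hz. rewrite <- (RInt_derivative f f') by auto.
    assert (B1 : forall r, s <= r <= z -> f' r ^ 2 <= 1 ^ 2 * e r)
      by (intros r _; specialize (B r); lra).
    generalize (cauchy_schwarz_RInt f' e s z 1 Hsz F' E B1). intros C.
    assert (P : forall r, 0 <= e r)
      by (intros r; generalize (B r) (pow2_ge_0 (f' r)); lra).
    assert (C1 := RInt_split e 0 s T E). assert (C2 := RInt_split e s z T E).
    assert (0 <= RInt e 0 s) by (apply RInt_nonneg; auto; lra).
    assert (0 <= RInt e s z) by (apply RInt_nonneg; auto; lra).
    assert (0 <= RInt e z T) by (apply RInt_nonneg; auto; lra).
    rewrite <- sqrt_Rsqr_abs. apply sqrt_le_1_alt. unfold Rsqr.
    assert ((z - s) * RInt e s z <= T * RInt e 0 T)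
      by (apply Rmult_le_compat; lra).
    lra. }
  intros s z Hs Hz. destruct (Rtotal_order s z) as [|[->|]].
  - apply K; lra.
  - rewrite Rminus_diag, Rabs_R0. apply sqrt_pos.
  - rewrite Rabs_minus_sym. apply K; lra.
Qed.

(** Averaging [f z - f s] over [s] leaves [f z], because [f] has mean zero. Since [e] only has to
    dominate the square of [f'], the full dissipation density can take its place. *)
Lemma poincare (f f' e : R -> R) T : 0 < T ->
  (forall z, is_derive f z (f' z)) -> (forall z, continuous f' z) ->
  (forall z, continuous e z) -> (forall z, f' z ^ 2 <= e z) ->
  RInt f 0 T = 0 ->
  forall z, 0 <= z <= T -> Rabs (f z) <= sqrt (T * RInt e 0 T).
Proof.
  intros H F F' E B Z z Hz. set (g := sqrt (T * RInt e 0 T)).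
  assert (Fc : forall s, continuous f s)
    by (intros s; apply (ex_derive_continuous (V := R_NormedModule)); eexists; apply F).
  assert (K : Rabs (RInt (fun s => 1 * f z + (-1) * f s) 0 T) <= RInt (fun _ => g) 0 T).
  { apply RInt_abs_le; [lra | | intros; apply continuous_const |].
    - intros s.
      apply (continuous_plus (V := R_NormedModule) (fun _ => 1 * f z) (fun s => -1 * f s));
        [apply continuous_const | apply (continuous_scal_r (V := R_NormedModule) (-1) f), Fc].
    - intros s Hs. replace (1 * f z + -1 * f s) with (f z - f s) by ring.
      now apply (oscillation_bound f f' e). }
  rewrite (RInt_lin (fun _ => f z) f), !RInt_constant, Z in K
    by auto using continuous_const.
  replace (1 * (f z * (T - 0)) + -1 * 0) with (f z * T) in K by ring.
  rewrite Rabs_mult, (Rabs_pos_eq T), Rminus_0_r in K by lra.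
  now apply Rmult_le_reg_r in K.
Qed.

(** * Integrals over a period and the divergence theorem *)

Definition avg (T : R) (f : R3 -> R) (x : R) : R := RInt (fun z => f (x, 0, z)) 0 T.

Lemma continuous_slice f x z : smooth f -> continuous (fun z => f (x, 0, z)) z.
Proof.
  intros F.
  apply (continuous_comp (fun z => (x, 0, z) : R3) f); [|apply (smooth_C1 _ F)].
  apply (continuous_R3 (fun _ => x) (fun _ => 0) (fun z => z));
    auto using continuous_const, continuous_id.
Qed.
#[global] Hint Resolve continuous_slice : smooth.

Lemma continuity_2d_slice f x z : smooth f ->
  continuity_2d_pt (fun x z => f (x, 0, z)) x z.
Proof.
  intros F. apply (continuity_2d_slices f (fun x _ => x) (fun _ _ => 0) (fun _ z => z));
    [apply (smooth_C1 _ F) | apply continuity_2d_pt_id1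
    | apply continuity_2d_pt_const | apply continuity_2d_pt_id2].
Qed.

Lemma is_derive_slice1 f x z : smooth f ->
  is_derive (fun x => f (x, 0, z)) x (pd D1 f (x, 0, z)).
Proof. intros F. exact (is_derive_upd f D1 (0, 0, z) x (smooth_C1 _ F)). Qed.

Lemma is_derive_slice3 f x z : smooth f ->
  is_derive (fun z => f (x, 0, z)) z (pd D3 f (x, 0, z)).
Proof. intros F. exact (is_derive_upd f D3 (x, 0, 0) z (smooth_C1 _ F)). Qed.

Section Averages.
Context (T : R).
Local Notation "⟨ f ⟩" := (avg T f) (at level 0, f at level 200).

Lemma avg_ext f g x : (forall z, f (x, 0, z) = g (x, 0, z)) -> ⟨f⟩ x = ⟨g⟩ x.
Proof. intros H. apply RInt_ext. intros z _. apply H. Qed.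

Lemma avg_add f g x : smooth f -> smooth g -> ⟨fadd f g⟩ x = ⟨f⟩ x + ⟨g⟩ x.
Proof.
  intros F G. rewrite <- (Rmult_1_l (⟨f⟩ x)), <- (Rmult_1_l (⟨g⟩ x)).
  unfold avg. rewrite <- RInt_lin by sm.
  apply RInt_ext; intros z _. unfold fadd. now rewrite !Rmult_1_l.
Qed.

Lemma avg_scal c f x : smooth f -> ⟨fscal c f⟩ x = c * ⟨f⟩ x.
Proof.
  intros F. unfold avg, fscal. apply (RInt_scal (V := R_CompleteNormedModule)).
  apply ex_RInt_cont; sm.
Qed.

Lemma avg_mul_coord1 f x : smooth f -> ⟨fmul (coord D1) f⟩ x = x * ⟨f⟩ x.
Proof.
  intros F. rewrite <- avg_scal by sm. now apply avg_ext.
Qed.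

Lemma is_derive_avg f x : smooth f -> is_derive ⟨f⟩ x (⟨pd D1 f⟩ x).
Proof.
  intros F.
  assert (D : forall u v, Derive (fun z => f (z, 0, v)) u = pd D1 f (u, 0, v))
    by (intros; now apply is_derive_unique, is_derive_slice1).
  replace (⟨pd D1 f⟩ x) with (RInt (fun t => Derive (fun u => f (u, 0, t)) x) 0 T)
    by (apply RInt_ext; intros; apply D).
  apply (is_derive_RInt_param (fun x z => f (x, 0, z))).
  - apply filter_forall. intros u t _. eexists; now apply is_derive_slice1.
  - intros t _. apply continuity_2d_pt_ext with (fun u v => pd D1 f (u, 0, v));
      [intros; now rewrite D|]. apply (continuity_2d_slice (pd D1 f)); sm.
  - apply filter_forall. intros u. apply ex_RInt_cont; sm.
Qed.

Lemma avg_pd3 f x : smooth f -> ⟨pd D3 f⟩ x = f (x, 0, T) - f (x, 0, 0).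
Proof.
  intros F. apply (RInt_derivative (fun z => f (x, 0, z)));
    intros z; [now apply is_derive_slice3 | sm].
Qed.

Lemma avg_pd3_periodic f x : smooth f -> periodic T f -> ⟨pd D3 f⟩ x = 0.
Proof.
  intros F P. rewrite avg_pd3 by sm. specialize (P x 0 0).
  rewrite Rplus_0_l in P. rewrite P. ring.
Qed.

Lemma avg_abs_le f M x : 0 <= T -> smooth f ->
  (forall z, 0 <= z <= T -> Rabs (f (x, 0, z)) <= M) -> Rabs (⟨f⟩ x) <= T * M.
Proof.
  intros HT F B. unfold avg. replace (T * M) with (M * (T - 0)) by ring.
  rewrite <- RInt_constant.
  apply RInt_abs_le; sm. intros; apply continuous_const.
Qed.

(** The [z]-component of the reduced flux: on [y = 0], [x div V] is the divergence in [(x, z)] of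
    the pair formed by [x V1] and this function. The term with [sigma] comes from the [y]-derivative
    of [V2]. *)
Definition side_flux (sigma : R) (V : dir -> R3 -> R) : R3 -> R :=
  fadd (fscal sigma (V D2)) (fmul (coord D1) (V D3)).

Lemma smooth_side_flux sigma V : (forall d, smooth (V d)) -> smooth (side_flux sigma V).
Proof. intros; unfold side_flux; sm. Qed.

(** On [y = 0] the identity [L (V D2) = - V D1] reads [x d_y V2 = V1 + sigma d_z V2], which
    eliminates the only derivative that leaves the half-plane. *)
Lemma dv_slice sigma V x z : equivariant sigma V ->
  x * dv V (x, 0, z)
  = V D1 (x, 0, z) + x * pd D1 (V D1) (x, 0, z) + pd D3 (side_flux sigma V) (x, 0, z).
Proof.
  intros [V0 [_ [V2 _]]]. unfold side_flux. pd_simpl.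
  apply (f_equal (fun g => g (x, 0, z))) in V2. revert V2.
  unfold dv, Lie, fadd, fmul, fscal, fconst; simpl. lra.
Qed.

(** The boundary terms are kept because the formula also serves on intervals that are not periods:
    [is_derive_psi_x] applies it on [[0, z]]. *)
Lemma is_derive_flux sigma V x : equivariant sigma V ->
  is_derive (fun x => x * ⟨V D1⟩ x) x
    (x * ⟨dv V⟩ x - (side_flux sigma V (x, 0, T) - side_flux sigma V (x, 0, 0))).
Proof.
  intros HV. assert (V0 := proj1 HV).
  assert (W := smooth_side_flux sigma V V0).
  rewrite <- avg_pd3 by sm.
  replace (x * ⟨dv V⟩ x - ⟨pd D3 (side_flux sigma V)⟩ x)
    with (1 * ⟨V D1⟩ x + x * ⟨pd D1 (V D1)⟩ x).
  - apply (is_derive_mult (fun x => x) ⟨V D1⟩ x 1).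
    + apply (is_derive_id (K := R_AbsRing)).
    + now apply is_derive_avg.
    + intros; apply Rmult_comm.
  - rewrite <- !avg_mul_coord1 by sm.
    rewrite (avg_ext (fmul (coord D1) (dv V)) (fadd (V D1)
      (fadd (fmul (coord D1) (pd D1 (V D1))) (pd D3 (side_flux sigma V))))).
    + rewrite !avg_add, !avg_mul_coord1 by sm. ring.
    + intros z. unfold fmul, fadd; simpl. rewrite (dv_slice sigma) by auto. ring.
Qed.

Lemma divergence_theorem sigma V x : equivariant sigma V ->
  (forall d, periodic T (V d)) ->
  is_derive (fun x => x * ⟨V D1⟩ x) x (x * ⟨dv V⟩ x).
Proof.
  intros HV P.
  replace (x * ⟨dv V⟩ x) with (x * ⟨dv V⟩ x
    - (side_flux sigma V (x, 0, T) - side_flux sigma V (x, 0, 0)));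
    [now apply is_derive_flux|].
  assert (PT : forall d, V d (x, 0, T) = V d (x, 0, 0))
    by (intros d; generalize (P d x 0 0); rewrite Rplus_0_l; auto).
  unfold side_flux, fadd, fmul, fscal; simpl. rewrite !PT.
  now rewrite Rminus_diag, Rminus_0_r.
Qed.

(** The flux [x <V1>] has zero derivative, and its factor [x] makes it vanish on the axis. *)
Lemma avg_D1_zero sigma V x : equivariant sigma V ->
  (forall d, periodic T (V d)) -> dv V = fconst 0 -> 0 < x -> ⟨V D1⟩ x = 0.
Proof.
  intros HV P D Hx.
  assert (E : 0 * ⟨V D1⟩ 0 = x * ⟨V D1⟩ x).
  { apply (eq_is_derive (V := R_NormedModule) (fun x => x * ⟨V D1⟩ x)); auto.
    intros t _. generalize (divergence_theorem sigma V t HV P).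
    rewrite D. unfold avg, fconst. now rewrite RInt_constant, Rmult_0_l, Rmult_0_r. }
  rewrite Rmult_0_l in E. symmetry in E.
  apply Rmult_integral in E. lra.
Qed.

End Averages.

(** * One-dimensional Liouville lemmas *)

Lemma mean_value_le (f f' : R -> R) a b : a <= b ->
  (forall x, a <= x <= b -> is_derive f x (f' x)) ->
  (forall x, a <= x <= b -> 0 <= f' x) -> f a <= f b.
Proof.
  intros H D P.
  destruct (MVT_gen f a b f') as [c [C E]];
    rewrite ?(Rmin_left a b H), ?(Rmax_right a b H) in *.
  - intros x Hx; apply D; lra.
  - intros x Hx. apply continuity_pt_filterlim.
    apply (ex_derive_continuous (V := R_NormedModule)). eexists; now apply D.
  - specialize (P c C). assert (0 <= f' c * (b - a)) by (apply Rmult_le_pos; lra). lra.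
Qed.

(* With [l = ln (N / x)] the combination
   [l^4 E + 4 l^3 B / x - K^2 (4 l + 6)^3 / 12] is nondecreasing on [x0, N]:
   [x] times its derivative is at least [(l^2 q - K (4 l + 6))^2].
   It is negative at [N], and letting [N] tend to infinity kills all but the
   first term. *)
Lemma logarithmic_liouville (E e B b q : R -> R) (K : R) :
  (forall x, 1 <= x -> is_derive E x (e x)) ->
  (forall x, 1 <= x -> is_derive B x (b x)) ->
  (forall x, 1 <= x -> q x ^ 2 = x * e x) ->
  (forall x, 1 <= x -> Rabs (E x - b x) <= K * q x) ->
  (forall x, 1 <= x -> Rabs (B x) <= K * q x) ->
  forall x0, 1 <= x0 -> E x0 <= 0.
Proof.
  intros HE HB Q A BB x0 Hx0.
  assert (Main : forall l0, 0 < l0 ->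
    l0 ^ 4 * E x0 + 4 * l0 ^ 3 * B x0 / x0 <= K ^ 2 * (4 * l0 + 6) ^ 3 / 12).
  { intros l0 Hl0.
    set (l := fun x => l0 + ln x0 - ln x).
    set (N := x0 * exp l0).
    assert (HN : x0 < N).
    { unfold N. generalize (exp_ineq1 l0). intros H. nra. }
    assert (lN : l N = 0).
    { unfold l, N. rewrite ln_mult, ln_exp by (try lra; apply exp_pos). ring. }
    assert (l0x : l x0 = l0) by (unfold l; ring).
    set (g := fun x => l x ^ 4 * E x + 4 * l x ^ 3 * B x / x
                       - K ^ 2 * (4 * l x + 6) ^ 3 / 12).
    assert (Hg : g x0 <= g N).
    { apply (mean_value_le g (fun x =>
        (l x ^ 4 * (x * e x) - 4 * l x ^ 3 * (E x - b x)
         - (12 * l x ^ 2 + 4 * l x ^ 3) * (B x / x)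
         + K ^ 2 * (4 * l x + 6) ^ 2) / x)); [lra | |].
      - intros x Hx. unfold g, l.
        assert (H1 : 1 <= x) by lra.
        assert (XE : ex_derive E x) by (eexists; now apply HE).
        assert (XB : ex_derive B x) by (eexists; now apply HB).
        auto_derive.
        + repeat split; auto; lra.
        + replace (Derive (fun x : R => E x) x) with (e x)
            by (symmetry; apply is_derive_unique, HE, H1).
          replace (Derive (fun x : R => B x) x) with (b x)
            by (symmetry; apply is_derive_unique, HB, H1). field. lra.
      - intros x Hx. assert (H1 : 1 <= x) by lra.
        apply Rmult_le_pos; [|apply Rlt_le, Rinv_0_lt_compat; lra].
        rewrite <- Q by lra. specialize (A x H1). specialize (BB x H1).
        assert (Hl : 0 <= l x).
        { unfold l. unfold N in Hx.
          assert (ln x <= ln (x0 * exp l0)) by (apply ln_le; lra).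
          rewrite ln_mult, ln_exp in H by (try lra; apply exp_pos). lra. }
        assert (BX : Rabs (B x / x) <= K * q x).
        { unfold Rdiv. rewrite Rabs_mult.
          assert (Rabs (/ x) <= 1).
          { rewrite Rabs_pos_eq by (apply Rlt_le, Rinv_0_lt_compat; lra).
            rewrite <- Rinv_1. apply Rinv_le_contravar; lra. }
          generalize (Rabs_pos (B x)) (Rabs_pos (/ x)). nra. }
        apply Rabs_le_between in A. apply Rabs_le_between in BX.
        set (y := l x) in *. set (v := q x) in *. set (w := E x - b x) in *.
        set (t := B x / x) in *.
        assert (0 <= y ^ 3) by (apply pow_le; auto).
        assert (0 <= y ^ 2) by apply pow2_ge_0.
        assert (P1 : 4 * y ^ 3 * w <= 4 * y ^ 3 * (K * v))
          by (apply Rmult_le_compat_l; lra).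
        assert (P2 : (12 * y ^ 2 + 4 * y ^ 3) * t <= (12 * y ^ 2 + 4 * y ^ 3) * (K * v))
          by (apply Rmult_le_compat_l; lra).
        (* The two error terms add up to at most [(8 y^3 + 12 y^2) K v], which is
           [2 (y^2 v) (K (4 y + 6))]. The cubic in the combination is chosen so that its derivative
           completes this square. *)
        generalize (pow2_ge_0 (y ^ 2 * v - K * (4 * y + 6))). intros P3.
        replace ((y ^ 2 * v - K * (4 * y + 6)) ^ 2) with
          (y ^ 4 * v ^ 2 - 4 * y ^ 3 * (K * v) - (12 * y ^ 2 + 4 * y ^ 3) * (K * v)
           + K ^ 2 * (4 * y + 6) ^ 2) in P3 by ring.
        lra. }
    unfold g in Hg. rewrite lN, l0x in Hg.
    generalize (pow2_ge_0 K). intros. unfold Rdiv in *. lra. }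
  apply Rnot_lt_le. intros HP.
  set (C := Rabs (B x0)).
  assert (HC : 0 <= C) by apply Rabs_pos.
  (* At [l0 = y = 6 + m], [y E x0] exceeds [4 C + 11 K^2] by [6 E x0]. Since [y >= 6],
     [4 y + 6 <= 5 y], and 11 is a round bound for [125 / 12]. *)
  set (m := (11 * K ^ 2 + 4 * C) / E x0).
  assert (Hm : 0 <= m).
  { unfold m. apply Rdiv_le_0_compat; auto. generalize (pow2_ge_0 K); lra. }
  assert (Em : m * E x0 = 11 * K ^ 2 + 4 * C) by (unfold m; field; lra).
  set (y := 6 + m).
  specialize (Main y ltac:(unfold y; lra)).
  assert (Hy : 6 <= y) by (unfold y; lra).
  assert (H3 : 0 < y ^ 3) by (apply pow_lt; lra).
  assert (B1 : - C <= B x0 / x0).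
  { assert (- B x0 <= C) by (unfold C; rewrite <- Rabs_Ropp; apply Rle_abs).
    assert (X : - C * x0 <= B x0) by nra.
    apply Rmult_le_reg_r with x0; [lra|]. unfold Rdiv.
    rewrite Rmult_assoc, Rinv_l by lra. lra. }
  assert (B2 : (4 * y + 6) ^ 3 / 12 <= 11 * y ^ 3).
  { assert ((4 * y + 6) ^ 3 <= (5 * y) ^ 3) by (apply pow_incr; lra).
    replace ((5 * y) ^ 3) with (125 * y ^ 3) in H by ring. lra. }
  assert (B3 : K ^ 2 * ((4 * y + 6) ^ 3 / 12) <= K ^ 2 * (11 * y ^ 3))
    by (apply Rmult_le_compat_l; auto using pow2_ge_0).
  assert (B4 : y ^ 3 * (y * E x0 - 4 * C - 11 * K ^ 2) <= 0).
  { assert (4 * y ^ 3 * (- C) <= 4 * y ^ 3 * (B x0 / x0))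
      by (apply Rmult_le_compat_l; lra).
    unfold Rdiv in *. lra. }
  assert (B5 : y * E x0 - 4 * C - 11 * K ^ 2 = 6 * E x0) by (unfold y; lra).
  rewrite B5 in B4. assert (0 < y ^ 3 * (6 * E x0)) by (apply Rmult_lt_0_compat; lra).
  lra.
Qed.

(** Integrating from 1 to [1 + s] shows that [|a| s^2 / 2] grows at most linearly in [s]. The start
    at 1 keeps the interval inside [x > 0], where the derivative is known. *)
Lemma no_linear_growth (f r : R -> R) a C D :
  (forall x, 0 < x -> is_derive f x (a * x + r x)) ->
  (forall x, Rabs (r x) <= C) -> (forall x, Rabs (f x) <= D) -> a = 0.
Proof.
  intros F HR B.
  assert (K : forall s, 0 <= s -> Rabs a * s ^ 2 / 2 <= 2 * D + C * s).
  { intros s Hs.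
    assert (X1 : f 1 - a / 2 + C <= f (1 + s) - a * (1 + s) ^ 2 / 2 + C * (1 + s)).
    { replace (f 1 - a / 2 + C) with (f 1 - a * 1 ^ 2 / 2 + C * 1) by field.
      apply (mean_value_le (fun x => f x - a * x ^ 2 / 2 + C * x)
        (fun x => r x + C)); [lra | |].
      - intros x Hx. assert (Hf := F x ltac:(lra)).
        assert (ex_derive f x) by (eexists; eauto).
        auto_derive; auto. replace (Derive (fun x : R => f x) x) with (a * x + r x)
          by (symmetry; now apply is_derive_unique). field.
      - intros x _. specialize (HR x). apply Rabs_le_between in HR. lra. }
    assert (X2 : - (f 1 - a / 2 - C) <= - (f (1 + s) - a * (1 + s) ^ 2 / 2 - C * (1 + s))).
    { replace (- (f 1 - a / 2 - C)) with (- (f 1 - a * 1 ^ 2 / 2 - C * 1)) by field.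
      apply (mean_value_le (fun x => - (f x - a * x ^ 2 / 2 - C * x))
        (fun x => C - r x)); [lra | |].
      - intros x Hx. assert (Hf := F x ltac:(lra)).
        assert (ex_derive f x) by (eexists; eauto).
        auto_derive; auto. replace (Derive (fun x : R => f x) x) with (a * x + r x)
          by (symmetry; now apply is_derive_unique). field.
      - intros x _. specialize (HR x). apply Rabs_le_between in HR. lra. }
    assert (B1 := B 1). assert (B2 := B (1 + s)).
    apply Rabs_le_between in B1. apply Rabs_le_between in B2.
    unfold Rabs; destruct (Rcase_abs a); nra. }
  destruct (Req_dec a 0) as [|Ha]; auto. exfalso.
  apply Rabs_pos_lt in Ha.
  assert (HD : 0 <= D) by (generalize (B 0) (Rabs_pos (f 0)); lra).
  assert (HC : 0 <= C) by (generalize (HR 0) (Rabs_pos (r 0)); lra).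
  set (m := (2 * D + C) / Rabs a).
  assert (Em : m * Rabs a = 2 * D + C) by (unfold m; field; lra).
  assert (Hm : 0 <= m) by (unfold m; apply Rdiv_le_0_compat; lra).
  (* For [s >= 1] the bound gives [|a| s^2 / 2 <= (2 D + C) s], that is [s <= 2 m]; the choice
     [s = 1 + 2 m] contradicts it. *)
  specialize (K (1 + 2 * m) ltac:(lra)). nra.
Qed.

(** * Energy balance *)

Definition sq_grad (V : dir -> R3 -> R) : R3 -> R :=
  fadd (dot (grad (V D1)) (grad (V D1)))
    (fadd (dot (grad (V D2)) (grad (V D2))) (dot (grad (V D3)) (grad (V D3)))).

Lemma smooth_sq_grad V : (forall d, smooth (V d)) -> smooth (sq_grad V).
Proof. intros. unfold sq_grad, grad. sm. Qed.

Lemma sq_grad_ge V i d p : pd d (V i) p ^ 2 <= sq_grad V p.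
Proof.
  assert (Q : forall i d, 0 <= pd d (V i) p ^ 2) by (intros; apply pow2_ge_0).
  generalize (Q D1 D1) (Q D1 D2) (Q D1 D3) (Q D2 D1) (Q D2 D2) (Q D2 D3)
    (Q D3 D1) (Q D3 D2) (Q D3 D3).
  unfold sq_grad, dot, grad, fadd, fmul. destruct i, d; lra.
Qed.

Lemma sq_grad_nonneg V p : 0 <= sq_grad V p.
Proof. eapply Rle_trans; [apply pow2_ge_0 | apply (sq_grad_ge V D1 D1)]. Qed.

Lemma lap_mul f g : smooth f -> smooth g ->
  lap (fmul f g) = fadd (fmul (lap f) g)
    (fadd (fscal 2 (dot (grad f) (grad g))) (fmul f (lap g))).
Proof. intros F G. unfold lap. pd_simpl. field_ext. Qed.

Lemma lap_add f g : smooth f -> smooth g -> lap (fadd f g) = fadd (lap f) (lap g).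
Proof. intros F G. unfold lap. pd_simpl. field_ext. Qed.

Lemma abs_dot_le V W M p : (forall d, Rabs (V d p) <= M) ->
  (forall d, Rabs (W d p) <= M) -> Rabs (dot V W p) <= 3 * M ^ 2.
Proof.
  intros A B.
  assert (K : forall d, Rabs (V d p * W d p) <= M ^ 2).
  { intros d. rewrite Rabs_mult. replace (M ^ 2) with (M * M) by ring.
    apply Rmult_le_compat; auto using Rabs_pos. }
  unfold dot, fadd, fmul.
  generalize (K D1) (K D2) (K D3).
  generalize (V D1 p * W D1 p) (V D2 p * W D2 p) (V D3 p * W D3 p).
  intros a b c Ha Hb Hc.
  apply Rabs_le_between in Ha, Hb, Hc. apply Rabs_le. lra.
Qed.

Definition energy (U H : dir -> R3 -> R) : R3 -> R :=
  fscal (1 / 2) (fadd (dot U U) (dot H H)).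

Definition energy_flux (U H : dir -> R3 -> R) (P : R3 -> R) : dir -> R3 -> R :=
  vadd (grad (energy U H))
    (vadd (vmul (fscal (-1) (fadd (energy U H) P)) U) (vmul (dot U H) H)).

(** The part of [axial_flux] free of derivatives. It is bounded by [2 M^2], and each term of its
    first component contains [u1] or [h1], which are small with [rms]. *)
Definition axial_transport (U H : dir -> R3 -> R) : dir -> R3 -> R :=
  vadd (vmul (fscal (-1) (U D3)) U) (vmul (H D3) H).

Definition axial_flux (U H : dir -> R3 -> R) : dir -> R3 -> R :=
  vadd (grad (U D3)) (axial_transport U H).

Lemma smooth_energy U H : (forall d, smooth (U d)) -> (forall d, smooth (H d)) ->
  smooth (energy U H).
Proof. intros; unfold energy; sm. Qed.

Lemma smooth_axial_transport U H d :
  (forall d, smooth (U d)) -> (forall d, smooth (H d)) ->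
  smooth (axial_transport U H d).
Proof. intros; unfold axial_transport, vadd, vmul; sm. Qed.

Lemma smooth_axial_flux U H d :
  (forall d, smooth (U d)) -> (forall d, smooth (H d)) -> smooth (axial_flux U H d).
Proof.
  intros; unfold axial_flux, vadd. apply smooth_add; [sm | now apply smooth_axial_transport].
Qed.
#[global] Hint Resolve smooth_sq_grad smooth_energy smooth_axial_transport
  smooth_axial_flux smooth_side_flux : smooth.

Lemma continuous_Rmult (f g : R -> R) z :
  continuous f z -> continuous g z -> continuous (fun z => f z * g z) z.
Proof. apply (continuous_mult (K := R_AbsRing)). Qed.

Lemma continuous_Rplus (f g : R -> R) z :
  continuous f z -> continuous g z -> continuous (fun z => f z + g z) z.
Proof. apply (continuous_plus (V := R_NormedModule)). Qed.

Lemma RInt_Rplus (f g : R -> R) a b :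
  (forall z, continuous f z) -> (forall z, continuous g z) ->
  RInt (fun z => f z + g z) a b = RInt f a b + RInt g a b.
Proof.
  intros F G. apply (RInt_plus (V := R_CompleteNormedModule));
    now apply ex_RInt_cont.
Qed.

Lemma RInt_Rscal (f : R -> R) c a b : (forall z, continuous f z) ->
  RInt (fun z => c * f z) a b = c * RInt f a b.
Proof.
  intros F. apply (RInt_scal (V := R_CompleteNormedModule)).
  now apply ex_RInt_cont.
Qed.

Section SteadyMHD.
Context (sigma T M : R) (HT : 0 < T) (HM : 0 <= M).
Context (U H : dir -> R3 -> R) (P : R3 -> R).
Context (EU : equivariant sigma U) (EH : equivariant sigma H) (SP : smooth P).
Context (PU : forall d, periodic T (U d)) (PH : forall d, periodic T (H d)).
Context (BU : forall d p, Rabs (U d p) <= M) (BH : forall d p, Rabs (H d p) <= M).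
Context (DU : dv U = fconst 0) (DH : dv H = fconst 0).
Context (MU : forall d, pd d P = fadd (lap (U d))
  (fadd (fscal (-1) (dot U (grad (U d)))) (dot H (grad (H d))))).
Context (MH : forall d, lap (H d) = fadd (dot U (grad (H d)))
  (fscal (-1) (dot H (grad (U d))))).

Let SU : forall d, smooth (U d) := proj1 EU.
Let SH : forall d, smooth (H d) := proj1 EH.

Local Notation "⟨ f ⟩" := (avg T f) (at level 0, f at level 200).
Local Notation G := (axial_flux U H).

(** * Axial momentum; periodicity and invariance of the pressure *)

Lemma dv_axial_flux : dv G = pd D3 P.
Proof.
  unfold axial_flux, axial_transport.
  rewrite dv_add by (unfold vadd, vmul; sm).
  rewrite dv_add by (unfold vmul; sm).
  rewrite !dv_mul, DU, DH, MU by sm. change (dv (grad (U D3))) with (lap (U D3)).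
  unfold dot, grad. pd_simpl. field_ext.
Qed.

Lemma equivariant_axial_flux : equivariant sigma G.
Proof.
  apply equivariant_add; [|apply equivariant_add].
  - now apply equivariant_grad, invariant_D3.
  - apply equivariant_mul; auto. now apply invariant_scal, invariant_D3.
  - apply equivariant_mul; auto. now apply invariant_D3.
Qed.

Lemma periodic_axial_flux d : periodic T (G d).
Proof.
  unfold axial_flux, axial_transport, vadd, vmul, grad.
  auto 8 using periodic_add, periodic_mul, periodic_scal, periodic_pd.
Qed.

Lemma abs_axial_transport_le d p : Rabs (axial_transport U H d p) <= 2 * M ^ 2.
Proof.
  unfold axial_transport, vadd, vmul, fadd, fmul, fscal.
  assert (A : Rabs (U D3 p * U d p) <= M * M)
    by (rewrite Rabs_mult; apply Rmult_le_compat; auto using Rabs_pos).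
  assert (B : Rabs (H D3 p * H d p) <= M * M)
    by (rewrite Rabs_mult; apply Rmult_le_compat; auto using Rabs_pos).
  apply Rabs_le_between in A, B. apply Rabs_le. lra.
Qed.

Lemma periodic_grad_pressure d : periodic T (pd d P).
Proof.
  rewrite MU. unfold lap, dot, grad.
  repeat (apply periodic_add || apply periodic_scal || apply periodic_mul
          || apply periodic_pd); auto; sm.
Qed.

(* A nonzero pressure drop over one period would force the mean axial velocity
   to grow quadratically, as in Poiseuille flow. *)
Lemma periodic_pressure : periodic T P.
Proof.
  set (a := P (0, 0, 0 + T) - P (0, 0, 0)).
  assert (C : forall x y z, P (x, y, z + T) - P (x, y, z) = a)
    by (intros; apply shift_difference_constant; auto using periodic_grad_pressure).
  enough (a = 0) by (intros x y z; specialize (C x y z); lra).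
  assert (A : forall x, ⟨pd D3 P⟩ x = a).
  { intros x. rewrite avg_pd3 by sm. rewrite <- (C x 0 0), Rplus_0_l. reflexivity. }
  (* The derivative of [x <G1>] is [x <P_z> = a x], and [x <G1>] vanishes on the axis. The gradient
     part of [G1] is the derivative of [<u3>], so [<u3>] falls under [no_linear_growth]. *)
  assert (F : forall x, 0 < x -> ⟨G D1⟩ x = a / 2 * x).
  { intros x Hx.
    assert (E : 0 * ⟨G D1⟩ 0 - a * 0 ^ 2 / 2 = x * ⟨G D1⟩ x - a * x ^ 2 / 2).
    { apply (eq_is_derive (V := R_NormedModule)
        (fun x => x * ⟨G D1⟩ x - a * x ^ 2 / 2)); auto.
      intros t _.
      assert (D : is_derive (fun x => x * ⟨G D1⟩ x - a * x ^ 2 / 2) t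
                    (t * ⟨dv G⟩ t - a * t)).
      { apply (is_derive_minus (V := R_NormedModule) (fun x => x * ⟨G D1⟩ x)
          (fun x => a * x ^ 2 / 2)).
        - apply (divergence_theorem T sigma);
            auto using equivariant_axial_flux, periodic_axial_flux.
        - auto_derive; auto. field. }
      rewrite dv_axial_flux, A in D.
      replace (t * a - a * t) with 0 in D by ring. exact D. }
    apply Rmult_eq_reg_l with x; lra. }
  enough (a / 2 = 0) by lra.
  apply (no_linear_growth ⟨U D3⟩
    (fun x => - ⟨axial_transport U H D1⟩ x) (a / 2) (T * (2 * M ^ 2)) (T * M)).
  - intros x Hx. rewrite <- F by auto.
    replace (⟨G D1⟩ x + - ⟨axial_transport U H D1⟩ x) with (⟨pd D1 (U D3)⟩ x).
    + now apply is_derive_avg.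
    + unfold axial_flux, vadd, grad. rewrite avg_add by sm. ring.
  - intros x. rewrite Rabs_Ropp. apply avg_abs_le; [lra | sm |].
    intros; apply abs_axial_transport_le.
  - intros x. apply avg_abs_le; [lra | sm | auto].
Qed.

(** The Lie derivative of [P] is a constant by [pd_Lie_zero]. On the axis it equals [sigma P_z],
    whose integral over a period vanishes since [P] is periodic; so the constant is zero. *)
Lemma invariant_pressure : invariant sigma P.
Proof.
  split; auto.
  assert (EP : equivariant sigma (grad P)).
  { replace (grad P) with (vadd (fun d => lap (U d))
      (vadd (vmul (fconst (-1)) (fun d => dot U (grad (U d))))
            (fun d => dot H (grad (H d)))))
      by (extensionality d; unfold grad at 3; now rewrite MU).
    apply equivariant_add; [now apply equivariant_lap|].
    apply equivariant_add; [|now apply equivariant_adv].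
    apply equivariant_mul; [|now apply equivariant_adv].
    split; [sm | apply Lie_const]. }
  assert (K := constant_of_pd _ (smooth_Lie sigma P SP) (pd_Lie_zero sigma P EP SP)).
  assert (Z : T * Lie sigma P (0, 0, 0) = 0).
  { assert (E : ⟨Lie sigma P⟩ 0 = T * Lie sigma P (0, 0, 0)).
    { rewrite (avg_ext T _ (fconst (Lie sigma P (0, 0, 0)))) by (intros; apply K).
      unfold avg, fconst. rewrite RInt_constant. now rewrite Rminus_0_r, Rmult_comm. }
    rewrite <- E, (avg_ext T _ (fscal sigma (pd D3 P))).
    - rewrite avg_scal, avg_pd3_periodic by auto using periodic_pressure with smooth.
      apply Rmult_0_r.
    - intros z. unfold Lie, fadd, fscal, fmul; simpl. ring. }
  extensionality p. rewrite (K p (0, 0, 0)). unfold fconst.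
  apply Rmult_integral in Z. lra.
Qed.

Definition dissipation : R3 -> R := fadd (sq_grad U) (sq_grad H).

Local Notation F := (energy_flux U H P).

(** The momentum equation is multiplied by [U] and the induction equation by [H]. The magnetic terms
    coupling the two combine into the divergence of [(U . H) H], and the squared gradients come from
    the Laplacian of the energy. *)
Lemma dv_energy_flux : dv F = dissipation.
Proof.
  unfold energy_flux.
  rewrite dv_add by (unfold vadd, vmul; sm).
  rewrite dv_add by (unfold vmul; sm).
  rewrite !dv_mul, DU, DH by sm.
  change (dv (grad (energy U H))) with (lap (energy U H)).
  unfold energy. rewrite lap_scal by sm. unfold dot at 1 2.
  rewrite !lap_add, !lap_mul by sm.
  assert (LU : forall d, lap (U d) = fadd (pd d P)
      (fadd (dot U (grad (U d))) (fscal (-1) (dot H (grad (H d))))))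
    by (intros d; rewrite MU; field_ext).
  rewrite !LU, !MH. unfold dissipation, sq_grad, dot, grad. pd_simpl.
  extensionality p. unfold fadd, fmul, fscal, fconst. field.
Qed.

Lemma equivariant_energy_flux : equivariant sigma F.
Proof.
  assert (Q : invariant sigma (energy U H))
    by (apply invariant_scal, invariant_add; now apply invariant_dot).
  apply equivariant_add; [now apply equivariant_grad|].
  apply equivariant_add; apply equivariant_mul; auto.
  - apply invariant_scal, invariant_add; auto using invariant_pressure.
  - now apply invariant_dot.
Qed.

Lemma periodic_energy_flux d : periodic T (F d).
Proof.
  assert (Q : periodic T (energy U H))
    by (apply periodic_scal, periodic_add; now apply periodic_dot).
  unfold energy_flux, vadd, vmul, grad.
  apply periodic_add; [apply periodic_pd; sm|].
  apply periodic_add; apply periodic_mul; auto.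
  - apply periodic_scal, periodic_add; auto using periodic_pressure.
  - now apply periodic_dot.
Qed.

(** * The stream function and the elimination of the pressure *)

Definition psi (x z : R) : R := x * avg z (U D1) x.

Local Notation W := (side_flux sigma U).

Lemma is_derive_psi_z x z : is_derive (psi x) z (x * U D1 (x, 0, z)).
Proof.
  apply (is_derive_scal (fun z => avg z (U D1) x)).
  apply (is_derive_RInt (V := R_CompleteNormedModule) (fun z => U D1 (x, 0, z)) _ 0).
  - apply filter_forall. intros b.
    apply (RInt_correct (V := R_CompleteNormedModule)), ex_RInt_cont; sm.
  - sm.
Qed.

(** [psi] is the stream function of the divergence-free pair [(x u1, W)] in the variables [(x, z)].
    The term [W (x, 0, 0)] results from normalising [psi] to vanish at [z = 0]. *)
Lemma is_derive_psi_x x z :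
  is_derive (fun x => psi x z) x (W (x, 0, 0) - W (x, 0, z)).
Proof.
  generalize (is_derive_flux z sigma U x EU). rewrite DU.
  unfold avg at 2, fconst. rewrite RInt_constant, Rmult_0_l, Rmult_0_r.
  replace (0 - (W (x, 0, z) - W (x, 0, 0))) with (W (x, 0, 0) - W (x, 0, z)) by ring.
  auto.
Qed.

Lemma continuous_psi x z : continuous (psi x) z.
Proof.
  apply (ex_derive_continuous (V := R_NormedModule)).
  eexists; apply is_derive_psi_z.
Qed.
Hint Resolve continuous_psi continuous_Rmult continuous_Rplus continuous_const : smooth.

Lemma psi_0 x : psi x 0 = 0.
Proof. unfold psi, avg. rewrite RInt_point. apply Rmult_0_r. Qed.

Lemma psi_T x : 0 < x -> psi x T = 0.
Proof.
  intros Hx. unfold psi. rewrite (avg_D1_zero T sigma); auto. ring.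
Qed.

Lemma abs_psi_le x z A : 0 < x -> 0 <= z <= T ->
  (forall s, 0 <= s <= T -> Rabs (U D1 (x, 0, s)) <= A) ->
  Rabs (psi x z) <= x * (T * A).
Proof.
  intros Hx Hz B. unfold psi. rewrite Rabs_mult, (Rabs_pos_eq x) by lra.
  apply Rmult_le_compat_l; [lra|].
  assert (0 <= A) by (generalize (B 0 ltac:(lra)) (Rabs_pos (U D1 (x, 0, 0))); lra).
  apply Rle_trans with (z * A); [|apply Rmult_le_compat_r; lra].
  apply avg_abs_le; [lra | sm |]. intros; apply B; lra.
Qed.

(** Required for differentiating [corrector] under the integral sign. At fixed [z], [psi] is
    differentiable in [x]; in [z] it is Lipschitz with constant at most [(|x| + 1) M], uniformly for
    first arguments within distance 1 of [x]. *)
Lemma continuity_2d_psi x z : continuity_2d_pt psi x z.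
Proof.
  assert (X : continuous (fun x => psi x z) x)
    by (apply (ex_derive_continuous (V := R_NormedModule)); eexists; apply is_derive_psi_x).
  intros eps.
  destruct (proj1 (filterlim_locally _ _) X (mkposreal _ (is_pos_div_2 eps)))
    as [d1 Hx].
  set (K := (Rabs x + 1) * M + 1).
  assert (HK : 0 < K) by (unfold K; generalize (Rabs_pos x); nra).
  assert (Hd2 : 0 < eps / 2 / K)
    by (apply Rdiv_lt_0_compat; [apply (is_pos_div_2 eps) | auto]).
  assert (Hd : 0 < Rmin (Rmin d1 1) (eps / 2 / K))
    by (repeat apply Rmin_glb_lt; auto using Rlt_0_1; apply cond_pos).
  exists (mkposreal _ Hd). simpl. intros u v Hu Hv.
  assert (Hu1 : Rabs (u - x) < d1)
    by (eapply Rlt_le_trans; [exact Hu | eapply Rle_trans; apply Rmin_l]).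
  assert (Hu2 : Rabs (u - x) < 1)
    by (eapply Rlt_le_trans; [exact Hu | eapply Rle_trans; [apply Rmin_l | apply Rmin_r]]).
  assert (Hv1 : Rabs (v - z) < eps / 2 / K)
    by (eapply Rlt_le_trans; [exact Hv | apply Rmin_r]).
  replace (psi u v - psi x z) with ((psi u v - psi u z) + (psi u z - psi x z)) by ring.
  eapply Rle_lt_trans; [apply Rabs_triang|].
  assert (E1 : Rabs (psi u z - psi x z) < eps / 2) by (apply (Hx u Hu1)).
  destruct (ex_MVT_point (psi u) (fun z => u * U D1 (u, 0, z)) z v) as [c [_ Ec]].
  { intros t; apply is_derive_psi_z. }
  rewrite Ec, !Rabs_mult.
  assert (Au : Rabs u <= Rabs x + 1).
  { replace u with (x + (u - x)) by ring.
    eapply Rle_trans; [apply Rabs_triang | lra]. }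
  assert (E2 : Rabs u * Rabs (U D1 (u, 0, c)) <= (Rabs x + 1) * M)
    by (apply Rmult_le_compat; auto using Rabs_pos).
  assert (E3 : Rabs u * Rabs (U D1 (u, 0, c)) * Rabs (v - z) <= K * (eps / 2 / K)).
  { apply Rmult_le_compat; auto using Rabs_pos.
    - apply Rmult_le_pos; apply Rabs_pos.
    - unfold K; lra.
    - lra. }
  replace (K * (eps / 2 / K)) with (eps / 2) in E3 by (field; lra).
  lra.
Qed.

(* [psi x] vanishes at both ends of a period, so no boundary term survives. *)
Lemma psi_by_parts f x : smooth f -> 0 < x ->
  RInt (fun z => psi x z * pd D3 f (x, 0, z)) 0 T = - (x * ⟨fmul (U D1) f⟩ x).
Proof.
  intros Sf Hx.
  assert (E : RInt (fun z => x * (U D1 (x, 0, z) * f (x, 0, z))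
                             + psi x z * pd D3 f (x, 0, z)) 0 T = 0).
  { rewrite (RInt_derivative (fun z => psi x z * f (x, 0, z))).
    - rewrite psi_0, psi_T, !Rmult_0_l by auto. apply Rminus_diag.
    - intros z. rewrite <- Rmult_assoc.
      apply (is_derive_mult (psi x) (fun z => f (x, 0, z)) z).
      + apply is_derive_psi_z.
      + now apply is_derive_slice3.
      + intros; apply Rmult_comm.
    - intros z. sm. }
  rewrite RInt_Rplus, RInt_Rscal in E by (intros; sm).
  unfold avg, fmul. lra.
Qed.

(** This is the [B] of [logarithmic_liouville]; its derivative contains the second derivatives of
    [U] that are never estimated. *)
Definition corrector (x : R) : R := RInt (fun z => psi x z * G D1 (x, 0, z)) 0 T.

Definition corrector_derivative (x : R) : R :=
  RInt (fun z => (W (x, 0, 0) - W (x, 0, z)) * G D1 (x, 0, z)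
                 + psi x z * pd D1 (G D1) (x, 0, z)) 0 T.

Lemma is_derive_corrector x : is_derive corrector x (corrector_derivative x).
Proof.
  assert (D : forall u v, is_derive (fun x => psi x v * G D1 (x, 0, v)) u
     ((W (u, 0, 0) - W (u, 0, v)) * G D1 (u, 0, v)
      + psi u v * pd D1 (G D1) (u, 0, v))).
  { intros u v. apply (is_derive_mult (fun x => psi x v) (fun x => G D1 (x, 0, v)) u).
    - apply is_derive_psi_x.
    - apply is_derive_slice1; sm.
    - intros; apply Rmult_comm. }
  assert (D' : forall u v, Derive (fun x => psi x v * G D1 (x, 0, v)) u
     = (W (u, 0, 0) - W (u, 0, v)) * G D1 (u, 0, v)
      + psi u v * pd D1 (G D1) (u, 0, v))
    by (intros; apply is_derive_unique, D).
  unfold corrector_derivative.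
  rewrite <- (RInt_ext (fun t => Derive (fun u => psi u t * G D1 (u, 0, t)) x))
    by (intros; apply D').
  apply (is_derive_RInt_param (fun x z => psi x z * G D1 (x, 0, z))).
  - apply filter_forall. intros u t _. eexists; apply D.
  - intros t _. apply continuity_2d_pt_ext with (fun u v =>
      (W (u, 0, 0) - W (u, 0, v)) * G D1 (u, 0, v)
      + psi u v * pd D1 (G D1) (u, 0, v)); [intros; now rewrite D'|].
    apply continuity_2d_pt_plus; apply continuity_2d_pt_mult.
    + apply continuity_2d_pt_minus; [|apply continuity_2d_slice; sm].
      apply (continuity_2d_slices W (fun u _ => u) (fun _ _ => 0) (fun _ _ => 0));
        auto using continuity_2d_pt_id1, continuity_2d_pt_const.
      apply smooth_C1; sm.
    + apply continuity_2d_slice; sm.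
    + apply continuity_2d_psi.
    + apply continuity_2d_slice; sm.
  - apply filter_forall. intros u. apply ex_RInt_cont. intros; sm.
Qed.

Definition transport_energy : R3 -> R :=
  fadd (pd D1 (energy U H))
    (fadd (fscal (-1) (fmul (energy U H) (U D1))) (fmul (dot U H) (H D1))).

(* The pressure contributes [- x <u1 P> = int psi P_z] (parts in z), and
   [P_z] is the divergence of the axial flux. *)
Lemma energy_flux_identity x : 0 < x ->
  x * ⟨F D1⟩ x - corrector_derivative x
  = x * ⟨transport_energy⟩ x + corrector x / x - ⟨fmul (U D1) (side_flux sigma G)⟩ x
    - RInt (fun z => (W (x, 0, 0) - W (x, 0, z)) * G D1 (x, 0, z)) 0 T.
Proof.
  intros Hx.
  assert (SE : smooth transport_energy) by (unfold transport_energy; sm).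
  assert (SG : smooth (side_flux sigma G)) by (apply smooth_side_flux; intros; sm).
  assert (E1 : ⟨F D1⟩ x = ⟨transport_energy⟩ x + - ⟨fmul (U D1) P⟩ x).
  { replace (- ⟨fmul (U D1) P⟩ x) with (-1 * ⟨fmul (U D1) P⟩ x) by ring.
    rewrite <- avg_scal, <- avg_add by sm. apply avg_ext. intros z.
    unfold energy_flux, transport_energy, vadd, vmul, grad, fadd, fmul, fscal. ring. }
  assert (E2 := psi_by_parts P x SP Hx).
  (* The factor [x] is the one in [dv_slice] and is cancelled at the end. The last integral is again
     of the form treated by [psi_by_parts], which exchanges [psi] for [u1]. *)
  assert (E3 : x * RInt (fun z => psi x z * pd D3 P (x, 0, z)) 0 T
    = corrector x + x * RInt (fun z => psi x z * pd D1 (G D1) (x, 0, z)) 0 T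
      + RInt (fun z => psi x z * pd D3 (side_flux sigma G) (x, 0, z)) 0 T).
  { rewrite <- !RInt_Rscal by (intros; sm). unfold corrector.
    rewrite <- !RInt_Rplus by (intros; sm).
    apply RInt_ext. intros z _. rewrite <- dv_axial_flux.
    generalize (dv_slice sigma G x z equivariant_axial_flux).
    generalize (dv G (x, 0, z)). intros r Hr.
    replace (x * (psi x z * r)) with (psi x z * (x * r)) by ring.
    rewrite Hr. simpl. ring. }
  rewrite (psi_by_parts (side_flux sigma G)) in E3 by auto.
  unfold corrector_derivative. rewrite RInt_Rplus by
    (intros; unfold Rminus; try apply continuous_Rmult;
     try apply continuous_Rplus; try apply (continuous_opp (V := R_NormedModule)); sm).
  rewrite E1, Rmult_plus_distr_l.
  replace (x * - ⟨fmul (U D1) P⟩ x)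
    with (RInt (fun z => psi x z * pd D3 P (x, 0, z)) 0 T) by (now rewrite E2, Ropp_mult_distr_r).
  clear E2. revert E3.
  generalize (RInt (fun z => psi x z * pd D3 P (x, 0, z)) 0 T : R). intros q E3.
  apply Rmult_eq_reg_l with x; [|lra]. field_simplify; [|lra].
  lra.
Qed.

(** * Estimates that are linear in the gradients *)

Definition rms (x : R) : R := sqrt (T * ⟨dissipation⟩ x).

Lemma smooth_dissipation : smooth dissipation.
Proof. unfold dissipation; sm. Qed.
Hint Resolve smooth_dissipation : smooth.

Lemma rms_nonneg x : 0 <= rms x.
Proof. apply sqrt_pos. Qed.

Lemma dissipation_ge V i d p : V = U \/ V = H -> pd d (V i) p ^ 2 <= dissipation p.
Proof.
  unfold dissipation, fadd. intros [-> | ->].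
  - generalize (sq_grad_ge U i d p) (sq_grad_nonneg H p). lra.
  - generalize (sq_grad_ge H i d p) (sq_grad_nonneg U p). lra.
Qed.

Lemma abs_radial_le_rms V x z : V = U \/ V = H -> 0 < x -> 0 <= z <= T ->
  Rabs (V D1 (x, 0, z)) <= rms x.
Proof.
  intros HV Hx Hz. unfold rms, avg.
  assert (SV : forall d, smooth (V d)) by (destruct HV; subst; auto).
  apply (poincare (fun z => V D1 (x, 0, z)) (fun z => pd D3 (V D1) (x, 0, z))
    (fun z => dissipation (x, 0, z))); auto; try solve [intros; sm].
  - intros s. now apply is_derive_slice3.
  - intros s. now apply (dissipation_ge V D1 D3).
  - destruct HV; subst; now apply (avg_D1_zero T sigma).
Qed.

Lemma weighted_gradient_le (m : R -> R) A V i d x : V = U \/ V = H -> 0 <= A ->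
  (forall z, continuous m z) -> (forall z, 0 <= z <= T -> Rabs (m z) <= A) ->
  Rabs (RInt (fun z => m z * pd d (V i) (x, 0, z)) 0 T) <= A * rms x.
Proof.
  intros HV HA Cm Bm. unfold rms, avg.
  assert (SV : forall d, smooth (V d)) by (destruct HV; subst; auto).
  apply abs_RInt_le_sqrt; auto; try solve [intros; sm].
  intros z Hz. rewrite Rpow_mult_distr.
  apply Rmult_le_compat; try apply pow2_ge_0; [|now apply (dissipation_ge V i d)].
  rewrite <- (pow2_abs (m z)). apply pow_incr. split; [apply Rabs_pos | auto].
Qed.

Lemma abs_RInt_le_constant (f : R -> R) A : (forall z, continuous f z) ->
  (forall z, 0 <= z <= T -> Rabs (f z) <= A) -> Rabs (RInt f 0 T) <= T * A.
Proof.
  intros C B. replace (T * A) with (A * (T - 0)) by ring. rewrite <- RInt_constant.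
  apply RInt_abs_le; auto; [lra | intros; apply continuous_const].
Qed.

(** The gradient part of the axial flux contributes the 1, and the two products in its transport
    part contribute [M T] each. *)
Let c := 1 + 2 * M * T.

(** The bound [N] stays free because the factor [rms] in the transport part has two possible
    sources: the first component of the transport, or the weight when [m] is [u1]. *)
Lemma weighted_axial_flux_le (m : R -> R) A N d x : 0 < x -> 0 <= A ->
  (forall z, continuous m z) -> (forall z, 0 <= z <= T -> Rabs (m z) <= A) ->
  (forall z, 0 <= z <= T ->
     Rabs (m z * axial_transport U H d (x, 0, z)) <= N) ->
  Rabs (RInt (fun z => m z * G d (x, 0, z)) 0 T) <= A * rms x + T * N.
Proof.
  intros Hx HA Cm Bm BN.
  rewrite (RInt_ext _ (fun z => m z * pd d (U D3) (x, 0, z)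
     + m z * axial_transport U H d (x, 0, z)))
    by (intros; apply Rmult_plus_distr_l).
  rewrite RInt_Rplus by (intros; sm).
  eapply Rle_trans; [apply Rabs_triang|]. apply Rplus_le_compat.
  - apply weighted_gradient_le; auto.
  - apply abs_RInt_le_constant; auto. intros; sm.
Qed.

Lemma abs_mult_le a b A B : Rabs a <= A -> Rabs b <= B -> Rabs (a * b) <= A * B.
Proof. intros. rewrite Rabs_mult. apply Rmult_le_compat; auto using Rabs_pos. Qed.

Lemma weighted_axial_flux1_le (m : R -> R) A x : 0 < x -> 0 <= A ->
  (forall z, continuous m z) -> (forall z, 0 <= z <= T -> Rabs (m z) <= A) ->
  Rabs (RInt (fun z => m z * G D1 (x, 0, z)) 0 T) <= A * c * rms x.
Proof.
  intros Hx HA Cm Bm.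
  replace (A * c * rms x) with (A * rms x + T * (A * (2 * (M * rms x))))
    by (unfold c; ring).
  apply weighted_axial_flux_le; auto. intros z Hz.
  apply abs_mult_le; auto.
  unfold axial_transport, vadd, vmul, fadd, fmul, fscal.
  assert (X := abs_mult_le _ _ _ _ (BU D3 (x, 0, z))
    (abs_radial_le_rms U x z (or_introl eq_refl) Hx Hz)).
  assert (Y := abs_mult_le _ _ _ _ (BH D3 (x, 0, z))
    (abs_radial_le_rms H x z (or_intror eq_refl) Hx Hz)).
  apply Rabs_le_between in X, Y. apply Rabs_le. lra.
Qed.

Lemma radial_axial_flux_le d x : 0 < x ->
  Rabs (⟨fmul (U D1) (G d)⟩ x) <= M * c * rms x.
Proof.
  intros Hx.
  replace (M * c * rms x) with (M * rms x + T * (rms x * (2 * M ^ 2)))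
    by (unfold c; ring).
  apply (weighted_axial_flux_le (fun z => U D1 (x, 0, z))); auto.
  - intros; sm.
  - intros z Hz. apply abs_mult_le; [|apply abs_axial_transport_le].
    apply abs_radial_le_rms; auto.
Qed.

Lemma abs_corrector_le x : 0 < x -> Rabs (corrector x) <= x * (T * M * c) * rms x.
Proof.
  intros Hx. rewrite <- !Rmult_assoc. unfold corrector.
  rewrite (Rmult_assoc x T M).
  apply weighted_axial_flux1_le; auto.
  - repeat apply Rmult_le_pos; lra.
  - sm.
  - intros z Hz. apply abs_psi_le; auto.
Qed.

Lemma abs_side_flux_weight_le x : 1 <= x ->
  Rabs (RInt (fun z => (W (x, 0, 0) - W (x, 0, z)) * G D1 (x, 0, z)) 0 T)
  <= 2 * (Rabs sigma + 1) * x * M * c * rms x.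
Proof.
  intros Hx.
  assert (B : forall z, Rabs (W (x, 0, z)) <= (Rabs sigma + 1) * x * M).
  { intros z. unfold side_flux, fadd, fscal, fmul; simpl.
    assert (X := abs_mult_le sigma _ _ _ (Rle_refl _) (BU D2 (x, 0, z))).
    assert (Y := abs_mult_le x _ x _ ltac:(rewrite Rabs_pos_eq; lra) (BU D3 (x, 0, z))).
    (* Here [1 <= x] enters: the term with [sigma] carries no factor [x] of its own. *)
    assert (Rabs sigma * M <= Rabs sigma * M * x).
    { rewrite <- (Rmult_1_r (Rabs sigma * M)) at 1. apply Rmult_le_compat_l; auto.
      apply Rmult_le_pos; auto using Rabs_pos. }
    eapply Rle_trans; [apply Rabs_triang|]. lra. }
  apply weighted_axial_flux1_le; [lra | | |].
  - repeat apply Rmult_le_pos; generalize (Rabs_pos sigma); lra.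
  - intros z. unfold Rminus. apply continuous_Rplus; [sm|].
    apply (continuous_opp (V := R_NormedModule)). apply continuous_slice; sm.
  - intros z _. assert (X := B 0). assert (Y := B z).
    apply Rabs_le_between in X, Y. apply Rabs_le. lra.
Qed.

Lemma abs_radial_side_flux_le x : 1 <= x ->
  Rabs (⟨fmul (U D1) (side_flux sigma G)⟩ x) <= (Rabs sigma + 1) * x * M * c * rms x.
Proof.
  intros Hx.
  assert (SG : forall d, smooth (G d)) by (intros; sm).
  rewrite (avg_ext T _ (fadd (fscal sigma (fmul (U D1) (G D2)))
    (fmul (coord D1) (fmul (U D1) (G D3))))).
  2:{ intros z. unfold side_flux, fadd, fmul, fscal. ring. }
  rewrite avg_add, avg_scal, avg_mul_coord1 by sm.
  assert (X := abs_mult_le sigma _ _ _ (Rle_refl _)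
    (radial_axial_flux_le D2 x ltac:(lra))).
  assert (Y := abs_mult_le x _ x _ ltac:(rewrite Rabs_pos_eq; lra)
    (radial_axial_flux_le D3 x ltac:(lra))).
  eapply Rle_trans; [apply Rabs_triang|].
  set (y := M * c * rms x) in *.
  assert (Hy : 0 <= y).
  { unfold y, c. repeat apply Rmult_le_pos; auto using rms_nonneg.
    assert (0 <= M * T) by (apply Rmult_le_pos; lra). lra. }
  assert (Rabs sigma * y <= Rabs sigma * y * x).
  { rewrite <- (Rmult_1_r (Rabs sigma * y)) at 1. apply Rmult_le_compat_l; auto.
    apply Rmult_le_pos; auto using Rabs_pos. }
  replace ((Rabs sigma + 1) * x * M * c * rms x) with ((Rabs sigma + 1) * x * y)
    by (unfold y; ring).
  lra.
Qed.

Lemma abs_transport_energy_le x : 0 < x ->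
  Rabs (⟨transport_energy⟩ x) <= (6 * M + 6 * T * M ^ 2) * rms x.
Proof.
  intros Hx. unfold transport_energy.
  assert (A : forall V i, V = U \/ V = H ->
    Rabs (⟨fmul (V i) (pd D1 (V i))⟩ x) <= M * rms x).
  { intros V i HV. apply (weighted_gradient_le (fun z => V i (x, 0, z))); auto;
      destruct HV; subst; auto; intros; sm. }
  assert (B1 : Rabs (⟨fmul (energy U H) (U D1)⟩ x) <= T * (3 * M ^ 2 * rms x)).
  { apply avg_abs_le; [lra | sm |]. intros z Hz.
    apply abs_mult_le; [|apply abs_radial_le_rms; auto].
    assert (X := abs_dot_le U U M (x, 0, z) ltac:(auto) ltac:(auto)).
    assert (Y := abs_dot_le H H M (x, 0, z) ltac:(auto) ltac:(auto)).
    unfold energy, fscal, fadd.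
    apply Rabs_le_between in X, Y. apply Rabs_le. lra. }
  assert (B2 : Rabs (⟨fmul (dot U H) (H D1)⟩ x) <= T * (3 * M ^ 2 * rms x)).
  { apply avg_abs_le; [lra | sm |]. intros z Hz.
    apply abs_mult_le; [|apply abs_radial_le_rms; auto].
    apply abs_dot_le; auto. }
  rewrite !avg_add, avg_scal by sm.
  assert (E : ⟨pd D1 (energy U H)⟩ x =
    (⟨fmul (U D1) (pd D1 (U D1))⟩ x + ⟨fmul (U D2) (pd D1 (U D2))⟩ x
     + ⟨fmul (U D3) (pd D1 (U D3))⟩ x)
    + (⟨fmul (H D1) (pd D1 (H D1))⟩ x + ⟨fmul (H D2) (pd D1 (H D2))⟩ x
     + ⟨fmul (H D3) (pd D1 (H D3))⟩ x)).
  { rewrite <- !avg_add by sm. apply avg_ext. intros z.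
    unfold energy, dot. pd_simpl. unfold fadd, fscal, fmul. field. }
  rewrite E.
  generalize (A U D1 (or_introl eq_refl)) (A U D2 (or_introl eq_refl))
    (A U D3 (or_introl eq_refl)) (A H D1 (or_intror eq_refl))
    (A H D2 (or_intror eq_refl)) (A H D3 (or_intror eq_refl)).
  intros Y1 Y2 Y3 Y4 Y5 Y6.
  apply Rabs_le_between in B1, B2, Y1, Y2, Y3, Y4, Y5, Y6. apply Rabs_le. lra.
Qed.

Lemma dissipation_zero x z : 0 < x -> 0 < z < T -> dissipation (x, 0, z) = 0.
Proof.
  intros Hx Hz.
  assert (Pos : forall p, 0 <= dissipation p)
    by (intros p; eapply Rle_trans;
        [apply pow2_ge_0 | apply (dissipation_ge U D1 D1); auto]).
  assert (APos : forall x, 0 <= ⟨dissipation⟩ x)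
    by (intros; apply RInt_nonneg; [lra | intros; sm | auto]).
  set (E := fun x => x * ⟨F D1⟩ x).
  assert (DE : forall x, is_derive E x (x * ⟨dissipation⟩ x)).
  { intros t. rewrite <- dv_energy_flux. apply (divergence_theorem T sigma);
      auto using equivariant_energy_flux, periodic_energy_flux. }
  (* One summand for each term of [energy_flux_identity]; of the three copies of
     [(Rabs sigma + 1) * M * c], two come from the weight [W (x, 0, 0) - W (x, 0, z)] and one from
     [u1] times the side flux. *)
  set (K := 6 * M + 6 * T * M ^ 2 + T * M * c + 3 * (Rabs sigma + 1) * M * c).
  assert (Hc : 0 <= c)
    by (unfold c; assert (0 <= M * T) by (apply Rmult_le_pos; lra); lra).
  assert (HMc : 0 <= M * c) by (apply Rmult_le_pos; auto).
  assert (HTMc : 0 <= T * (M * c)) by (apply Rmult_le_pos; lra).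
  assert (HM2 : 0 <= T * M ^ 2) by (apply Rmult_le_pos; [lra | apply pow2_ge_0]).
  assert (HsMc : 0 <= Rabs sigma * (M * c)) by (apply Rmult_le_pos; auto using Rabs_pos).
  assert (Large : forall y, 1 <= y -> E y <= 0).
  { apply (logarithmic_liouville E (fun x => x * ⟨dissipation⟩ x)
      corrector corrector_derivative (fun x => x * sqrt (⟨dissipation⟩ x)) (K * sqrt T)).
    - auto.
    - intros; apply is_derive_corrector.
    - intros y Hy. rewrite Rpow_mult_distr, pow2_sqrt by auto. ring.
    - intros y Hy.
      replace (K * sqrt T * (y * sqrt (⟨dissipation⟩ y))) with (K * (y * rms y))
        by (unfold rms; rewrite sqrt_mult by (auto; lra); ring).
      unfold E. rewrite energy_flux_identity by lra.
      assert (X1 := abs_mult_le y _ y _ ltac:(rewrite Rabs_pos_eq; lra)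
        (abs_transport_energy_le y ltac:(lra))).
      assert (X2 := abs_side_flux_weight_le y Hy).
      assert (X3 := abs_radial_side_flux_le y Hy).
      assert (X4 : Rabs (corrector y / y) <= y * (T * M * c) * rms y).
      { unfold Rdiv. rewrite <- (Rmult_1_r (y * (T * M * c) * rms y)).
        apply abs_mult_le; [apply abs_corrector_le; lra|].
        rewrite Rabs_pos_eq by (apply Rlt_le, Rinv_0_lt_compat; lra).
        rewrite <- Rinv_1. apply Rinv_le_contravar; lra. }
      unfold K.
      apply Rabs_le_between in X1, X2, X3, X4. apply Rabs_le. lra.
    - intros y Hy.
      replace (K * sqrt T * (y * sqrt (⟨dissipation⟩ y))) with (K * (y * rms y))
        by (unfold rms; rewrite sqrt_mult by (auto; lra); ring).
      eapply Rle_trans; [apply abs_corrector_le; lra|].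
      replace (y * (T * M * c) * rms y) with (T * M * c * (y * rms y)) by ring.
      apply Rmult_le_compat_r; [apply Rmult_le_pos; [lra | apply rms_nonneg]|].
      unfold K. lra. }
  assert (Mono : forall a b, 0 <= a <= b -> E a <= E b).
  { intros a b Hab. apply (mean_value_le E (fun x => x * ⟨dissipation⟩ x)); try lra; auto.
    intros y Hy. apply Rmult_le_pos; auto; lra. }
  (* The sign is known from 1 on only; monotonicity carries it down to the axis by comparison with
     [y + 1]. *)
  assert (Zero : forall y, 0 <= y -> E y = 0).
  { intros y Hy. apply Rle_antisym.
    - apply Rle_trans with (E (y + 1)); [apply Mono | apply Large]; lra.
    - replace 0 with (E 0) by (unfold E; apply Rmult_0_l). apply Mono; lra. }
  assert (A : x * ⟨dissipation⟩ x = 0).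
  { rewrite <- (is_derive_unique E x _ (DE x)). apply is_derive_unique.
    apply is_derive_ext_loc with (fun _ => 0);
      [|apply (is_derive_const (V := R_NormedModule))].
    exists (mkposreal x Hx). intros y Hy. symmetry. apply Zero.
    unfold ball in Hy; simpl in Hy; unfold AbsRing_ball, abs, minus, plus, opp in Hy;
      simpl in Hy. apply Rabs_def2 in Hy. lra. }
  apply Rmult_integral in A.
  apply (RInt_zero_pointwise (fun z => dissipation (x, 0, z)) 0 T); auto.
  - intros; sm.
  - destruct A as [A|A]; [lra | exact A].
Qed.

End SteadyMHD.

(** * From vanishing gradients to constant fields *)

(** Equivariance writes [V1] and [V2], up to sign, as Lie derivatives of each other, hence as
    combinations of vanishing first derivatives. [V3] is constant along segments joining any point
    of the strip to the base point. *)
Lemma slice_of_zero_gradient sigma T V : 0 < T -> equivariant sigma V ->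
  (forall x z, 0 < x -> 0 < z < T -> sq_grad V (x, 0, z) = 0) ->
  forall x z, 0 < x -> 0 < z < T ->
  V D1 (x, 0, z) = 0 /\ V D2 (x, 0, z) = 0 /\ V D3 (x, 0, z) = V D3 (1, 0, T / 2).
Proof.
  intros HT [V0 [V1 [V2 _]]] Z.
  assert (D : forall i d x z, 0 < x -> 0 < z < T -> pd d (V i) (x, 0, z) = 0).
  { intros i d x z Hx Hz. generalize (sq_grad_ge V i d (x, 0, z)).
    rewrite Z by auto. intros Q.
    generalize (pow2_ge_0 (pd d (V i) (x, 0, z))). intros Q'.
    assert (E : pd d (V i) (x, 0, z) ^ 2 = 0) by lra.
    destruct (Req_dec (pd d (V i) (x, 0, z)) 0) as [|N]; auto.
    now apply (pow_nonzero _ 2) in N. }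
  intros x z Hx Hz. split; [|split].
  - apply (f_equal (fun f => f (x, 0, z))) in V2. revert V2.
    unfold Lie, fadd, fmul, fscal. rewrite !D by auto. lra.
  - apply (f_equal (fun f => f (x, 0, z))) in V1. revert V1.
    unfold Lie, fadd, fmul, fscal. rewrite !D by auto. lra.
  - assert (K1 : forall a b, 0 < a -> a < b -> V D3 (a, 0, z) = V D3 (b, 0, z)).
    { intros a b Ha Hab.
      apply (eq_is_derive (V := R_NormedModule) (fun t => V D3 (t, 0, z)) a b); auto.
      intros t Ht. generalize (is_derive_slice1 (V D3) t z (V0 D3)).
      now rewrite D by lra. }
    assert (K3 : forall a b, 0 < a -> a < b -> b < T -> V D3 (1, 0, a) = V D3 (1, 0, b)).
    { intros a b Ha Hab Hb.
      apply (eq_is_derive (V := R_NormedModule) (fun t => V D3 (1, 0, t)) a b); auto.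
      intros t Ht. generalize (is_derive_slice3 (V D3) 1 t (V0 D3)).
      now rewrite D by lra. }
    transitivity (V D3 (1, 0, z)).
    + destruct (Rtotal_order x 1) as [|[->|]]; auto. symmetry. apply K1; lra.
    + destruct (Rtotal_order z (T / 2)) as [|[->|]]; auto; [|symmetry];
        apply K3; lra.
Qed.

(** The helices through the open half-plane miss the axis, which is reached by continuity. *)
Lemma value_on_axis f z c : smooth f -> (forall x, 0 < x -> f (x, 0, z) = c) ->
  f (0, 0, z) = c.
Proof.
  intros F C. symmetry. apply cond_eq. intros eps Heps.
  assert (X : continuous (fun x => f (x, 0, z)) 0)
    by (apply (ex_derive_continuous (V := R_NormedModule)); eexists;
        now apply is_derive_slice1).
  destruct (proj1 (filterlim_locally _ _) X (mkposreal _ Heps)) as [[d Hd] D].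
  simpl in D. rewrite <- (C (d / 2)) by lra. apply D.
  unfold ball; simpl; unfold AbsRing_ball, abs, minus, plus, opp; simpl.
  apply Rabs_def1; lra.
Qed.

Lemma cos_sin_period_Z t (k : Z) :
  cos (t + 2 * IZR k * PI) = cos t /\ sin (t + 2 * IZR k * PI) = sin t.
Proof.
  destruct (Z_le_gt_dec 0 k) as [Hk|Hk].
  - rewrite <- (Z2Nat.id k Hk), <- INR_IZR_INZ. now rewrite cos_period, sin_period.
  - assert (E : IZR k = - INR (Z.to_nat (- k)))
      by (rewrite INR_IZR_INZ, Z2Nat.id, opp_IZR by lia; ring).
    rewrite <- (cos_period (t + 2 * IZR k * PI) (Z.to_nat (- k))).
    rewrite <- (sin_period (t + 2 * IZR k * PI) (Z.to_nat (- k))).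
    rewrite E. split; f_equal; ring.
Qed.

(** The sign of the sine follows [Rrot], which sends [(r, 0)] to [(r cos t, - r sin t)]. *)
Lemma polar_angle x y : let r := sqrt (x ^ 2 + y ^ 2) in
  0 < r -> exists t, x = r * cos t /\ y = - r * sin t.
Proof.
  intros r Hr.
  assert (R2 : r ^ 2 = x ^ 2 + y ^ 2)
    by (apply pow2_sqrt; generalize (pow2_ge_0 x) (pow2_ge_0 y); lra).
  set (a := x / r).
  assert (Ea : a * r = x) by (unfold a; field; lra).
  assert (Hy : 1 - a² = (y / r)²).
  { unfold Rsqr, a. apply Rmult_eq_reg_r with (r ^ 2); [|apply pow_nonzero; lra].
    field_simplify; [|lra|lra]. lra. }
  assert (Ha : -1 <= a <= 1)
    by (generalize (Rle_0_sqr (y / r)); unfold Rsqr in *; nra).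
  assert (S : r * sin (acos a) = Rabs y).
  { rewrite sin_acos, Hy, sqrt_Rsqr_abs by auto.
    unfold Rdiv. rewrite Rabs_mult, Rabs_inv, (Rabs_pos_eq r) by lra. field. lra. }
  destruct (Rle_dec y 0) as [Y|Y].
  - exists (acos a). rewrite cos_acos by auto. split; [lra|].
    rewrite Rabs_left1 in S by auto. lra.
  - exists (- acos a). rewrite cos_neg, sin_neg, cos_acos by auto. split; [lra|].
    rewrite Rabs_pos_eq in S by lra. lra.
Qed.

(* Two periods [2 pi |sigma|] are used so that the open interval contains a
   fundamental domain. *)
Lemma helix_through_slice sigma x y z : sigma <> 0 -> 0 < x ^ 2 + y ^ 2 ->
  exists rho r z', 0 < r /\ 0 < z' < 4 * PI * Rabs sigma /\
    Shel sigma rho (r, 0, z') = (x, y, z).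
Proof.
  intros Hs Hxy. assert (Hr := sqrt_lt_R0 _ Hxy).
  destruct (polar_angle x y Hr) as [t [Ex Ey]].
  set (r := sqrt (x ^ 2 + y ^ 2)) in *.
  assert (HP := PI_RGT_0). assert (Ha := Rabs_pos_lt _ Hs).
  assert (K : exists k : Z, 0 < z - sigma * (t + 2 * IZR k * PI) < 4 * PI * Rabs sigma).
  { set (w := (z - sigma * t) / (2 * PI * Rabs sigma)).
    assert (Ew : z - sigma * t = w * (2 * PI * Rabs sigma)) by (unfold w; field; lra).
    (* [up w] lies in [(w, w + 1]], so [w - n] lies in [[1, 2)], strictly inside the interval
       [(0, 2)] given by two periods. *)
    set (n := (up w - 2)%Z).
    assert (Hn : 1 <= w - IZR n < 2)
      by (unfold n; rewrite minus_IZR; generalize (archimed w); lra).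
    assert (Hm : 0 < 2 * PI * Rabs sigma) by (apply Rmult_lt_0_compat; lra).
    assert (B : 0 < (w - IZR n) * (2 * PI * Rabs sigma) < 2 * (2 * PI * Rabs sigma))
      by (split; [apply Rmult_lt_0_compat | apply Rmult_lt_compat_r]; lra).
    (* For negative [sigma], a full turn shifts [z] the other way, so the number of turns changes
       sign. *)
    destruct (Rle_dec 0 sigma) as [P|N].
    - exists n. rewrite Rabs_pos_eq in B, Ew |- * by auto. lra.
    - exists (- n)%Z. rewrite opp_IZR. rewrite Rabs_left in B, Ew |- * by lra. lra. }
  destruct K as [k Hk].
  exists (t + 2 * IZR k * PI), r, (z - sigma * (t + 2 * IZR k * PI)).
  split; [auto | split; [auto|]].
  unfold Shel, Rrot. destruct (cos_sin_period_Z t k) as [-> ->].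
  repeat f_equal; rewrite ?Ex, ?Ey; ring.
Qed.

Lemma helical_periodic sigma u d : helically_symmetric sigma u ->
  periodic (4 * PI * Rabs sigma) (comp d u).
Proof.
  intros Hu x y z.
  assert (K : exists k : Z, sigma * (0 + 2 * IZR k * PI) = 4 * PI * Rabs sigma).
  { destruct (Rle_dec 0 sigma) as [S|S].
    - exists 2%Z. rewrite Rabs_pos_eq by auto. ring.
    - exists (-2)%Z. rewrite Rabs_left by lra. ring. }
  destruct K as [k Hk]. destruct (cos_sin_period_Z 0 k) as [C S].
  specialize (Hu (0 + 2 * IZR k * PI) (x, y, z)).
  unfold Shel, Rrot in Hu. rewrite C, S, Hk, cos_0, sin_0 in Hu.
  replace (1 * x + 0 * y) with x in Hu by ring.
  replace (- 0 * x + 1 * y) with y in Hu by ring.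
  unfold comp. rewrite Hu. destruct (u (x, y, z)) as [[a b] c].
  destruct d; simpl; ring.
Qed.

Lemma helical_constant sigma u : sigma <> 0 -> smooth_vf u ->
  helically_symmetric sigma u ->
  (forall x z, 0 < x -> 0 < z < 4 * PI * Rabs sigma ->
     sq_grad (fun d => comp d u) (x, 0, z) = 0) ->
  exists C, forall p, u p = (0, 0, C).
Proof.
  intros Hs Su Hu Z.
  assert (HT : 0 < 4 * PI * Rabs sigma).
  { generalize PI_RGT_0 (Rabs_pos_lt _ Hs). intros.
    apply Rmult_lt_0_compat; lra. }
  assert (S := slice_of_zero_gradient sigma _ _ HT (Lie_helical sigma u Su Hu) Z).
  cbv beta in S.
  set (C := comp D3 u (1, 0, 4 * PI * Rabs sigma / 2)) in S.
  assert (Off : forall x y z, 0 < x ^ 2 + y ^ 2 -> u (x, y, z) = (0, 0, C)).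
  { intros x y z Hxy.
    destruct (helix_through_slice sigma x y z Hs Hxy) as [rho [r [z' [Hr [Hz <-]]]]].
    rewrite Hu. destruct (S r z' Hr Hz) as [A1 [A2 A3]].
    unfold comp in *. destruct (u (r, 0, z')) as [[a b] c]. simpl in *.
    subst a b c. repeat f_equal; ring. }
  exists C. intros [[x y] z].
  destruct (Rlt_dec 0 (x ^ 2 + y ^ 2)) as [|N]; [now apply Off|].
  generalize (pow2_ge_0 x) (pow2_ge_0 y). intros Qx Qy.
  assert (x = 0) by nra. assert (y = 0) by nra. subst x y.
  assert (A : forall d, comp d u (0, 0, z) = coord d (0, 0, C)).
  { intros d. apply value_on_axis; auto. intros x Hx. unfold comp.
    rewrite Off; [reflexivity | nra]. }
  assert (A1 := A D1). assert (A2 := A D2). assert (A3 := A D3).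
  unfold comp in *. destruct (u (0, 0, z)) as [[a b] c]. simpl in *. congruence.
Qed.

Theorem theorem1p1 (sigma : R) (u h : R3 -> R3) (P : R3 -> R) :
  sigma <> 0 ->
  smooth_vf u -> smooth_vf h -> smooth P ->
  bounded_vf u -> bounded_vf h ->
  steady_MHD u h P ->
  helically_symmetric sigma u -> helically_symmetric sigma h ->
  exists C1 C2 : R, forall p : R3, u p = (0, 0, C1) /\ h p = (0, 0, C2).
Proof.
  intros Hs Su Sh SP [Mu Bu] [Mh Bh] [E1 [E2 [E3 E4]]] Hu Hh.
  set (T := 4 * PI * Rabs sigma).
  set (M := Rmax Mu Mh).
  set (U := fun d => comp d u). set (H := fun d => comp d h).
  assert (HT : 0 < T).
  { generalize PI_RGT_0 (Rabs_pos_lt _ Hs). intros.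
    apply Rmult_lt_0_compat; lra. }
  assert (BU : forall d p, Rabs (U d p) <= M)
    by (intros; eapply Rle_trans; [apply Bu | apply Rmax_l]).
  assert (BH : forall d p, Rabs (H d p) <= M)
    by (intros; eapply Rle_trans; [apply Bh | apply Rmax_r]).
  assert (HM : 0 <= M)
    by (eapply Rle_trans; [apply Rabs_pos | apply (BU D1 (0, 0, 0))]).
  assert (Z : forall x z, 0 < x -> 0 < z < T -> dissipation U H (x, 0, z) = 0).
  { apply (dissipation_zero sigma T M HT HM U H P); auto.
    - now apply Lie_helical.
    - now apply Lie_helical.
    - intros; now apply helical_periodic.
    - intros; now apply helical_periodic.
    - extensionality p. specialize (E3 p). unfold Defs.div in E3.
      unfold dv, fadd, fconst, U. lra.
    - extensionality p. specialize (E4 p). unfold Defs.div in E4.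
      unfold dv, fadd, fconst, H. lra.
    - intros d. extensionality p. specialize (E1 d p).
      unfold laplacian, adv in E1.
      unfold lap, dot, grad, fadd, fscal, fmul, U, H. lra.
    - intros d. extensionality p. specialize (E2 d p).
      unfold laplacian, adv in E2.
      unfold lap, dot, grad, fadd, fscal, fmul, U, H. lra. }
  assert (Zu : forall x z, 0 < x -> 0 < z < T -> sq_grad U (x, 0, z) = 0).
  { intros x z Hx Hz. specialize (Z x z Hx Hz). unfold dissipation, fadd in Z.
    generalize (sq_grad_nonneg U (x, 0, z)) (sq_grad_nonneg H (x, 0, z)). lra. }
  assert (Zh : forall x z, 0 < x -> 0 < z < T -> sq_grad H (x, 0, z) = 0).
  { intros x z Hx Hz. specialize (Z x z Hx Hz). unfold dissipation, fadd in Z.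
    generalize (sq_grad_nonneg U (x, 0, z)) (sq_grad_nonneg H (x, 0, z)). lra. }
  destruct (helical_constant sigma u Hs Su Hu Zu) as [C1 HC1].
  destruct (helical_constant sigma h Hs Sh Hh Zh) as [C2 HC2].
  exists C1, C2. now split.
Qed.
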